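(* Let $\mathbf{x}$ be a smoothly embedded closed curve on a sphere of radius $R>0$ in $\mathbb{R}^3$ whose geodesic curvature $\kappa_g$ satisfies, with $B=\kappa_g^{-2/3}$ and some constant $C_1\in\mathbb{R}$, $$B_{ss}-2B^{-2}+R^{-2}B=\frac{C_1}2 .$$ Then $\mathbf{x}$ is a planar curve. In other words, the smoothly closed and embedded generalized equi-centro-affine extremal curves on a sphere are precisely planar circles.
   Context: $s$ is the Euclidean arc length parameter; the geodesic curvature is assumed nowhere zero, with orientation chosen so that $\kappa_g>0$. Curves on the sphere whose geodesic curvature satisfies the displayed equation for some constant $C_1$ are called generalized equi-centro-affine extremal curves. *)

(* Defs.v *)
From Stdlib Require Import Reals.
From Coquelicot Require Import Coquelicot.
Open Scope R_scope.

Definition vec3 : Type := (R * R * R)%type.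

Definition c1 (v : vec3) : R := fst (fst v).
Definition c2 (v : vec3) : R := snd (fst v).
Definition c3 (v : vec3) : R := snd v.

Definition vzero : vec3 := (0, 0, 0).

Definition vsub (u v : vec3) : vec3 :=
  (c1 u - c1 v, c2 u - c2 v, c3 u - c3 v).

Definition vscal (a : R) (v : vec3) : vec3 :=
  (a * c1 v, a * c2 v, a * c3 v).

Definition dot (u v : vec3) : R :=
  c1 u * c1 v + c2 u * c2 v + c3 u * c3 v.

Definition cross (u v : vec3) : vec3 :=
  (c2 u * c3 v - c3 u * c2 v,
   c3 u * c1 v - c1 u * c3 v,
   c1 u * c2 v - c2 u * c1 v).

Definition norm3 (v : vec3) : R := sqrt (dot v v).

Definition vderive_n (x : R -> vec3) (k : nat) (s : R) : vec3 :=
  (Derive_n (fun t => c1 (x t)) k s,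
   Derive_n (fun t => c2 (x t)) k s,
   Derive_n (fun t => c3 (x t)) k s).

Definition smooth (x : R -> vec3) : Prop :=
  forall (k : nat) (s : R),
    ex_derive_n (fun t => c1 (x t)) k s /\
    ex_derive_n (fun t => c2 (x t)) k s /\
    ex_derive_n (fun t => c3 (x t)) k s.

Definition arc_length_param (x : R -> vec3) : Prop :=
  forall s : R, norm3 (vderive_n x 1 s) = 1.

Definition simple_closed (x : R -> vec3) : Prop :=
  exists L : R,
    0 < L /\
    (forall s : R, x (s + L) = x s) /\
    (forall s t : R, 0 <= s < L -> 0 <= t < L -> x s = x t -> s = t).

Definition on_sphere (o : vec3) (r : R) (p : vec3) : Prop :=
  norm3 (vsub p o) = r.

(* A smoothly embedded closed curve on the sphere of centre o and radius r,
   given by its arc-length parametrization, periodically extended to R. *)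
Definition embedded_closed_on_sphere (o : vec3) (r : R) (x : R -> vec3) : Prop :=
  smooth x /\ arc_length_param x /\ simple_closed x /\
  (forall s : R, on_sphere o r (x s)).

(* <x'', N x x'> with N = (x - o)/r the outward unit normal of the sphere;
   this is the geodesic curvature for an arc-length parameter s.  Its sign
   changes when the direction of travel is reversed. *)
Definition geodesic_curvature (o : vec3) (r : R) (x : R -> vec3) (s : R) : R :=
  dot (vderive_n x 2 s)
      (cross (vscal (/ r) (vsub (x s) o)) (vderive_n x 1 s)).

Definition curvB (o : vec3) (r : R) (x : R -> vec3) (s : R) : R :=
  Rpower (geodesic_curvature o r x s) (- (2 / 3)).

Definition extremal_equation (o : vec3) (r : R) (x : R -> vec3) (C1 : R) : Prop :=
  forall s : R,
    Derive_n (curvB o r x) 2 s - 2 * / (curvB o r x s) ^ 2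
      + / r ^ 2 * curvB o r x s = C1 / 2.

(* Nowhere vanishing geodesic curvature, with the direction of travel chosen
   so that it is positive. *)
Definition positively_curved (o : vec3) (r : R) (x : R -> vec3) : Prop :=
  forall s : R, 0 < geodesic_curvature o r x s.

Definition gen_equi_centro_affine_extremal (o : vec3) (r : R) (x : R -> vec3) : Prop :=
  positively_curved o r x /\ exists C1 : R, extremal_equation o r x C1.

Definition planar (x : R -> vec3) : Prop :=
  exists (n : vec3) (c : R), n <> vzero /\ forall s : R, dot n (x s) = c.

(* The circle of centre q and radius rho in the plane through q orthogonal to n. *)
Definition circle (q : vec3) (rho : R) (n : vec3) (p : vec3) : Prop :=
  norm3 (vsub p q) = rho /\ dot n (vsub p q) = 0.

Definition trace (x : R -> vec3) (p : vec3) : Prop := exists s : R, x s = p.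

Definition traces_circle (x : R -> vec3) : Prop :=
  exists (q : vec3) (rho : R) (n : vec3),
    0 < rho /\ n <> vzero /\ forall p : vec3, trace x p <-> circle q rho n p.

(* Main.v *)
(** On the curve let [N] be the outward normal of the sphere, [T] the velocity,
    [V = N x T], [k] the geodesic curvature, [B = k^(-2/3)] and [D = B'].  The equation
    is the conservation of the momentum
      [A = D T + 2 k B V + (B/r - C r/2) N],
    so the height of the curve along [A] is an affine function of [B], and since
    [<A, V> = 2 k B > 0] the curve always turns in the same sense around [A].
    By uniqueness for the equation of [B], the curve is symmetric about each plane
    spanned by [A] and a vertex (a zero of [D]).

    Suppose [B] is not constant and start at a maximum of [B].  Simplicity and the
    symmetry force the curve to cross the plane of [A] and this vertex for the next time
    exactly after half the period, and this crossing is again a vertex.  If there is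
    no vertex in between, the integral of [k' <N, T_0>] over the half period gives a
    contradiction, as in the four vertex theorem.  Otherwise, the arc from the maximum
    to the next vertex subtends an angle of at most [pi/2] at the axis [A].
    In the affine parameter, [d/dsigma = B^(1/2) d/ds], the horizontal coordinates [w] of
    the curve solve a Hill equation [w'' + g w = 0], so that the products [P = w_1 w_2]
    solve [P''' + 4 g P' + 2 g' P = 0], while [B''' + 4 g B' + 2 g' B = (6/r^2) B B'].
    Sturm comparison of [B] with the product vanishing at the next vertex then shows
    that the angle exceeds [pi/2].

    With [B] constant, the curvature is constant and the curve is a circle. *)

From Stdlib Require Import ZArith Reals Lra Lia Nsatz.
From Coquelicot Require Import Coquelicot.
Require Import Defs.
Open Scope R_scope.

(** * Real analysis *)

Lemma is_derive_eq (f : R -> R) (s l l' : R) :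
  is_derive f s l -> l = l' -> is_derive f s l'.
Proof. now intros H <-. Qed.

Lemma der_ext (f g : R -> R) (s l : R) :
  (forall u, f u = g u) -> is_derive f s l -> is_derive g s l.
Proof. apply is_derive_ext. Qed.

Lemma der_const (c s : R) : is_derive (fun _ : R => c) s 0.
Proof. exact (is_derive_const c s). Qed.

Lemma der_id (s : R) : is_derive (fun u : R => u) s 1.
Proof. exact (is_derive_id s). Qed.

(** This and the next rules replace the abstract module operations of Coquelicot by those of [R], so
    that [ring] and [field] apply to the results. *)
Lemma der_opp (f : R -> R) (s f' : R) :
  is_derive f s f' -> is_derive (fun u => - f u) s (- f').
Proof. exact (is_derive_opp f s f'). Qed.

Lemma der_plus (f g : R -> R) (s f' g' : R) :
  is_derive f s f' -> is_derive g s g' -> is_derive (fun u => f u + g u) s (f' + g').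
Proof. exact (is_derive_plus f g s f' g'). Qed.

Lemma der_minus (f g : R -> R) (s f' g' : R) :
  is_derive f s f' -> is_derive g s g' -> is_derive (fun u => f u - g u) s (f' - g').
Proof. exact (is_derive_minus f g s f' g'). Qed.

Lemma der_mult (f g : R -> R) (s f' g' : R) :
  is_derive f s f' -> is_derive g s g' ->
  is_derive (fun u => f u * g u) s (f' * g s + f s * g').
Proof.
  intros Hf Hg.
  exact (is_derive_mult f g s f' g' Hf Hg Rmult_comm).
Qed.

Lemma der_pow (f : R -> R) (n : nat) (s f' : R) :
  is_derive f s f' -> is_derive (fun u => f u ^ n) s (INR n * f' * f s ^ pred n).
Proof. exact (is_derive_pow f n s f'). Qed.

Lemma der_inv (f : R -> R) (s f' : R) :
  is_derive f s f' -> f s <> 0 -> is_derive (fun u => / f u) s (- f' / f s ^ 2).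
Proof. exact (is_derive_inv f s f'). Qed.

Lemma der_shift (f f' : R -> R) (c u : R) :
  (forall s, is_derive f s (f' s)) -> is_derive (fun u => f (c + u)) u (f' (c + u)).
Proof.
  intros H. eapply is_derive_eq.
  - apply (is_derive_comp f (fun u => c + u)); [apply H|].
    apply der_plus; [apply der_const | apply der_id].
  - unfold scal; simpl; unfold mult; simpl; ring.
Qed.

Lemma der_reflect (f f' : R -> R) (c u : R) :
  (forall s, is_derive f s (f' s)) -> is_derive (fun u => f (c - u)) u (- f' (c - u)).
Proof.
  intros H. eapply is_derive_eq.
  - apply (is_derive_comp f (fun u => c - u)); [apply H|].
    apply der_minus; [apply der_const | apply der_id].
  - unfold scal; simpl; unfold mult; simpl; ring.
Qed.

(** Atoms are settled by hypotheses that give the derivative at every point; these are put in the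
    context before [der] is called. *)
Ltac der_leaf :=
  intros;
  match goal with
  | H : forall s, is_derive ?f s _ |- is_derive ?f _ _ => apply H
  | H : forall s, is_derive ?f s _ |- is_derive (fun u => ?f u) _ _ => apply H
  end.

Ltac der_rec :=
  cbv beta;
  lazymatch goal with
  | |- is_derive (fun u => u) _ _ => apply der_id
  | |- is_derive (fun _ => ?c) _ _ => apply der_const
  | |- is_derive (fun u => - @?f u) _ _ => eapply (der_opp f); der_rec
  | |- is_derive (fun u => @?f u + @?g u) _ _ => eapply (der_plus f g); der_rec
  | |- is_derive (fun u => @?f u - @?g u) _ _ => eapply (der_minus f g); der_rec
  | |- is_derive (fun u => @?f u / @?g u) _ _ =>
      eapply (der_mult f (fun u => / g u)); der_rec
  | |- is_derive (fun u => @?f u * @?g u) _ _ => eapply (der_mult f g); der_rec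
  | |- is_derive (fun _ => / ?c) _ _ => apply der_const
  | |- is_derive (fun u => / @?f u) _ _ => eapply (der_inv f); [der_rec | cbv beta]
  | |- is_derive (fun u => @?f u ^ ?n) _ _ => eapply (der_pow f n); der_rec
  | |- is_derive (fun u => ?f (?c + u)) _ _ => eapply (der_shift f); der_leaf
  | |- is_derive (fun u => ?f (?c - u)) _ _ => eapply (der_reflect f); der_leaf
  | |- _ => der_leaf
  end.

(* Leaves the identity between the computed and the expected derivative, after
   the conditions that denominators do not vanish. *)
Ltac der := eapply is_derive_eq; [der_rec | cbv beta; simpl INR; simpl pred].

Lemma der_continuity (f f' : R -> R) :
  (forall s, is_derive f s (f' s)) -> continuity f.
Proof.
  intros H s. apply derivable_continuous_pt. exists (f' s).
  now apply is_derive_Reals.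
Qed.

Lemma der_mvt (f f' : R -> R) (a b : R) :
  (forall s, is_derive f s (f' s)) -> a < b ->
  exists c, a < c < b /\ f b - f a = f' c * (b - a).
Proof.
  intros H ab.
  destruct (MVT_cor2 f f' a b ab) as [c [E I]].
  - intros c _. now apply is_derive_Reals.
  - now exists c.
Qed.

Lemma der_zero_const (f : R -> R) :
  (forall s, is_derive f s 0) -> forall a b, f a = f b.
Proof.
  intros H.
  assert (K : forall a b, a < b -> f a = f b).
  { intros a b ab. destruct (der_mvt f (fun _ => 0) a b H ab) as [c [_ E]]. lra. }
  intros a b. destruct (Rtotal_order a b) as [h | [-> | h]]; auto.
  symmetry; auto.
Qed.

Lemma der_of_const (f : R -> R) (c l s : R) :
  (forall u, f u = c) -> is_derive f s l -> l = 0.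
Proof.
  intros H D. rewrite <- (is_derive_unique _ _ _ D).
  rewrite (Derive_ext f (fun _ => c) s H). apply Derive_const.
Qed.

Lemma der_pos_increasing (f f' : R -> R) (a b : R) :
  (forall s, is_derive f s (f' s)) -> a < b ->
  (forall s, a < s < b -> 0 < f' s) -> f a < f b.
Proof.
  intros H ab P. destruct (der_mvt f f' a b H ab) as [c [I E]].
  specialize (P c I). nra.
Qed.

(** Near [a] the difference quotient stays within [l] of [l], hence positive. The product form
    treats both sides of [a] at once. *)
Lemma der_pos_sign (f : R -> R) (a l : R) :
  is_derive f a l -> f a = 0 -> 0 < l ->
  exists e, 0 < e /\ forall s, 0 < Rabs (s - a) < e -> 0 < (s - a) * f s.
Proof.
  intros H Z P. apply is_derive_Reals in H.
  destruct (H l P) as [[e ep] He]. exists e; split; [exact ep|].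
  intros s [h1 h2].
  assert (h : s - a <> 0) by (intros E; rewrite E, Rabs_R0 in h1; lra).
  specialize (He (s - a) h h2). simpl in He.
  replace (a + (s - a)) with s in He by ring. rewrite Z, Rminus_0_r in He.
  apply Rabs_def2 in He.
  assert (0 < f s / (s - a)) by lra.
  replace ((s - a) * f s) with ((s - a) * (s - a) * (f s / (s - a))) by now field.
  apply Rmult_lt_0_compat; [|assumption]. nra.
Qed.

Lemma no_zero_pos (f : R -> R) (a b u : R) :
  continuity f -> (forall s, a < s < b -> f s <> 0) -> a < u < b -> 0 < f u ->
  forall s, a < s < b -> 0 < f s.
Proof.
  intros C N U P s S.
  destruct (Rlt_le_dec 0 (f s)) as [h | h]; [exact h | exfalso].
  destruct (Rle_lt_dec s u) as [su | us].
  - destruct (IVT_cor f s u C su) as [z [I E]]; [nra|]. apply (N z); [lra | exact E].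
  - destruct (IVT_cor f u s C (Rlt_le _ _ us)) as [z [I E]]; [nra|].
    apply (N z); [lra | exact E].
Qed.

(** [c] is the supremum of the points up to which [f] stays negative. The initial interval of length
    [e] is there because [f] may vanish at [a] itself, as [D] does at a vertex. *)
Lemma first_zero (f : R -> R) (a b e : R) :
  continuity f -> 0 < e -> (forall s, a < s < a + e -> f s < 0) ->
  a < b -> f b = 0 ->
  exists c, a < c <= b /\ f c = 0 /\ forall s, a < s < c -> f s < 0.
Proof.
  intros C ep N ab Z.
  set (S := fun u => a <= u <= b /\ forall s, a < s < u -> f s < 0).
  destruct (completeness S) as [c [ub lub]].
  - exists b. intros u [h _]. lra.
  - exists a. split; [lra|]. intros s; lra.
  - assert (cb : c <= b) by (apply lub; intros u [h _]; lra).
    assert (ac : a < c).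
    { assert (h : Rmin (a + e) b <= c).
      { apply ub. split.
        - split; [apply Rmin_glb; lra | apply Rmin_r].
        - intros s h. apply N. pose proof (Rmin_l (a + e) b). lra. }
      assert (a < Rmin (a + e) b) by (apply Rmin_glb_lt; lra). lra. }
    assert (neg : forall s, a < s < c -> f s < 0).
    { intros s h. destruct (Rlt_le_dec (f s) 0) as [k | k]; [exact k | exfalso].
      assert (c <= s); [|lra].
      apply lub. intros u [_ hu]. destruct (Rle_lt_dec u s) as [g | g]; [exact g|].
      specialize (hu s). lra. }
    exists c. split; [lra | split; [|exact neg]].
    (* A negative value at [c] would prolong the negative stretch beyond the supremum; a positive
       one would spread to points left of [c]. *)
    destruct (Rtotal_order (f c) 0) as [h | [h | h]]; [exfalso | exact h | exfalso].
    + assert (c <> b) by (intros ->; lra).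
      destruct (proj1 (continuity_pt_locally f c) (C c) (mkposreal (- f c) ltac:(lra)))
        as [[d dp] Hd].
      simpl in Hd. set (u := Rmin (c + d / 2) b).
      assert (cu : c < u) by (apply Rmin_glb_lt; lra).
      assert (uS : S u); [|specialize (ub u uS); lra].
      split; [split; [lra | apply Rmin_r]|].
      intros s hs. destruct (Rlt_le_dec s c) as [k | k]; [apply neg; lra|].
      assert (u <= c + d / 2) by apply Rmin_l.
      assert (B : ball c d s).
      { unfold ball; simpl; unfold AbsRing_ball, abs, minus, plus, opp; simpl.
        apply Rabs_def1; lra. }
      specialize (Hd s B). apply Rabs_def2 in Hd. lra.
    + destruct (proj1 (continuity_pt_locally f c) (C c) (mkposreal (f c) ltac:(lra)))
        as [[d dp] Hd].
      simpl in Hd. set (s := Rmax (c - d / 2) ((a + c) / 2)).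
      assert (sc : s < c) by (apply Rmax_lub_lt; lra).
      assert (as_ : (a + c) / 2 <= s) by apply Rmax_r.
      assert (cs : c - d / 2 <= s) by apply Rmax_l.
      assert (B : ball c d s).
      { unfold ball; simpl; unfold AbsRing_ball, abs, minus, plus, opp; simpl.
        apply Rabs_def1; lra. }
      specialize (Hd s B). apply Rabs_def2 in Hd.
      assert (f s < 0) by (apply neg; lra). lra.
Qed.

(** Gronwall estimate: [(f^2 + g^2) exp (- (1 + K) s)] starts at 0 and has nonpositive derivative,
    because [|1 - q| <= 1 + K]. *)
Lemma linear_ode_zero (f g q : R -> R) (K : R) :
  (forall s, is_derive f s (g s)) ->
  (forall s, is_derive g s (- (q s * f s))) ->
  (forall s, 0 <= q s <= K) -> f 0 = 0 -> g 0 = 0 ->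
  forall s, f s = 0 /\ g s = 0.
Proof.
  assert (forward : forall f g q : R -> R,
    (forall s, is_derive f s (g s)) ->
    (forall s, is_derive g s (- (q s * f s))) ->
    (forall s, 0 <= q s <= K) -> f 0 = 0 -> g 0 = 0 ->
    forall s, 0 < s -> f s = 0 /\ g s = 0).
  { clear f g q. intros f g q Hf Hg Hq f0 g0 s sp.
    set (E := fun u => (f u * f u + g u * g u) * exp (- ((1 + K) * u))).
    set (E' := fun u => (2 * f u * g u * (1 - q u)
                        - (1 + K) * (f u * f u + g u * g u)) * exp (- ((1 + K) * u))).
    assert (HE : forall u, is_derive E u (E' u)).
    { intros u. eapply is_derive_eq.
      - apply der_mult.
        + apply der_plus; apply der_mult; auto.
        + apply (is_derive_comp exp (fun u => - ((1 + K) * u))).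
          * apply is_derive_exp.
          * apply der_opp, der_mult; [apply der_const | apply der_id].
      - unfold E', scal; simpl; unfold mult; simpl. ring. }
    destruct (der_mvt E E' 0 s HE sp) as [c [_ Ec]].
    assert (E' c <= 0).
    { unfold E'. pose proof (exp_pos (- ((1 + K) * c))). specialize (Hq c).
      assert (2 * f c * g c * (1 - q c) <= (1 + K) * (f c * f c + g c * g c)); [|nra].
      pose proof (Rle_0_sqr (f c - g c)) as h1. pose proof (Rle_0_sqr (f c + g c)) as h2.
      unfold Rsqr in h1, h2.
      destruct (Rle_lt_dec (q c) 1).
      - apply Rle_trans with ((f c * f c + g c * g c) * (1 - q c)); nra.
      - apply Rle_trans with ((f c * f c + g c * g c) * (q c - 1)); nra. }
    assert (Es : E s <= 0).
    { unfold E at 2 in Ec. rewrite f0, g0 in Ec. nra. }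
    unfold E in Es. pose proof (exp_pos (- ((1 + K) * s))).
    assert (f s * f s + g s * g s <= 0) by nra. split; nra. }
  intros Hf Hg Hq f0 g0 s.
  destruct (Rtotal_order s 0) as [h | [-> | h]]; [|now split | eapply forward; eauto].
  (* Negative times reduce to positive ones by reversing time, which changes the sign of [g]. *)
  destruct (forward (fun u => f (0 - u)) (fun u => - g (0 - u)) (fun u => q (0 - u)))
    with (s := - s) as [a b]; try lra.
  - intros u. der. ring.
  - intros u. der. ring.
  - intros u; apply Hq.
  - now rewrite Rminus_0_r.
  - rewrite Rminus_0_r, g0; ring.
  - cbv beta in a, b. replace (0 - - s) with s in a, b by ring. lra.
Qed.

(** * Periodic functions *)

Lemma period_shift (L s : R) : 0 < L -> exists z : Z, 0 <= s + IZR z * L < L.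
Proof.
  (* [up q - 1] is the integer part of [q]. *)
  intros Lp. exists (1 - up (s / L))%Z. rewrite minus_IZR.
  destruct (archimed (s / L)) as [h1 h2].
  assert (E : s = s / L * L) by (field; lra).
  set (q := s / L) in *. rewrite E. split; nra.
Qed.

Lemma periodic_IZR {A : Type} (f : R -> A) (L : R) :
  (forall s, f (s + L) = f s) -> forall (z : Z) s, f (s + IZR z * L) = f s.
Proof.
  intros P.
  assert (nat_case : forall (n : nat) s, f (s + INR n * L) = f s).
  { induction n as [|n IH]; intros s.
    - simpl. f_equal. ring.
    - rewrite S_INR. replace (s + (INR n + 1) * L) with (s + INR n * L + L) by ring.
      now rewrite P. }
  intros z s. destruct (Z.le_gt_cases 0 z) as [h | h].
  - rewrite <- (Z2Nat.id z h), <- INR_IZR_INZ. apply nat_case.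
  - rewrite <- (nat_case (Z.to_nat (- z)) (s + IZR z * L)).
    rewrite INR_IZR_INZ, Z2Nat.id, opp_IZR by lia. f_equal. ring.
Qed.

Lemma periodic_max (f : R -> R) (L : R) :
  0 < L -> continuity f -> (forall s, f (s + L) = f s) ->
  exists c, forall s, f s <= f c.
Proof.
  intros Lp C P.
  destruct (continuity_ab_maj f 0 L (Rlt_le _ _ Lp)) as [c [M _]].
  { intros; apply C. }
  exists c. intros s. destruct (period_shift L s Lp) as [z Hz].
  rewrite <- (periodic_IZR f L P z s). apply M. lra.
Qed.

(** * Vectors and frames *)

Definition vadd (u v : vec3) : vec3 := (c1 u + c1 v, c2 u + c2 v, c3 u + c3 v).

Ltac vec :=
  repeat match goal with v : vec3 |- _ => destruct v as [[? ?] ?] end;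
  unfold vadd, vsub, vscal, cross, dot, vzero, c1, c2, c3 in *; simpl fst in *; simpl snd in *.

Lemma dot_sym (u v : vec3) : dot u v = dot v u.
Proof. vec; ring. Qed.

Lemma dot_vadd_l (u v w : vec3) : dot (vadd u v) w = dot u w + dot v w.
Proof. vec; ring. Qed.

Lemma dot_vsub_l (u v w : vec3) : dot (vsub u v) w = dot u w - dot v w.
Proof. vec; ring. Qed.

Lemma dot_vscal_l (a : R) (u v : vec3) : dot (vscal a u) v = a * dot u v.
Proof. vec; ring. Qed.

Lemma dot_vadd_r (u v w : vec3) : dot u (vadd v w) = dot u v + dot u w.
Proof. vec; ring. Qed.

Lemma dot_vsub_r (u v w : vec3) : dot u (vsub v w) = dot u v - dot u w.
Proof. vec; ring. Qed.

Lemma dot_vscal_r (a : R) (u v : vec3) : dot u (vscal a v) = a * dot u v.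
Proof. vec; ring. Qed.

Ltac dots :=
  repeat first [rewrite dot_vadd_l | rewrite dot_vsub_l | rewrite dot_vscal_l
               | rewrite dot_vadd_r | rewrite dot_vsub_r | rewrite dot_vscal_r].

(** Vectors are compared, and vector functions differentiated, by pairing with every fixed [e]; the
    calculus thus stays real-valued. *)
Lemma vec_ext (u v : vec3) : (forall e, dot u e = dot v e) -> u = v.
Proof.
  intros H.
  pose proof (H (1, 0, 0)) as h1. pose proof (H (0, 1, 0)) as h2.
  pose proof (H (0, 0, 1)) as h3. clear H. vec.
  f_equal; [f_equal|]; lra.
Qed.

Lemma dot_cross_assoc (u v w : vec3) : dot (cross u v) w = dot u (cross v w).
Proof. vec; ring. Qed.

Lemma dot_cross_self_l (u v : vec3) : dot (cross u v) u = 0.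
Proof. vec; ring. Qed.

Lemma dot_cross_self_r (u v : vec3) : dot (cross u v) v = 0.
Proof. vec; ring. Qed.

Lemma double_cross_l (u v w : vec3) :
  cross (cross u v) w = vsub (vscal (dot u w) v) (vscal (dot v w) u).
Proof. vec. f_equal; [f_equal|]; ring. Qed.

Lemma dot_cross_cross (u v w z : vec3) :
  dot (cross u v) (cross w z) = dot u w * dot v z - dot u z * dot v w.
Proof. vec; ring. Qed.

(** The vectors [a] and [cross t a] are orthogonal to [t] and to each other and have equal length;
    the factor [dot a a] avoids normalizing them. *)
Lemma orthogonal_expansion (t a e f : vec3) :
  dot t t = 1 -> dot a t = 0 ->
  dot a a * (dot e f - dot t e * dot t f)
  = dot a e * dot a f + dot (cross t a) e * dot (cross t a) f.
Proof. intros. vec. nsatz. Qed.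

Lemma orthonormal_expansion (n t e f : vec3) :
  dot n n = 1 -> dot t t = 1 -> dot n t = 0 ->
  dot e f = dot n e * dot n f + dot t e * dot t f + dot (cross n t) e * dot (cross n t) f.
Proof. intros. vec. nsatz. Qed.

(** For a unit [t], the reflection in the plane orthogonal to [t]; being self-adjoint, it can act on
    either side of [dot]. *)
Definition reflect (t e : vec3) : vec3 := vsub e (vscal (2 * dot t e) t).

(** Run backwards from [c] with the tangent reversed, the first solution satisfies the same linear
    system as the second. The system is skew-symmetric, so the squared distance of the two is
    constant, and it vanishes at [u = 0]. *)
Lemma frenet_reflection (r c : R) (k n t v n' t' v' : R -> R) :
  (forall s, is_derive n s (t s / r)) ->
  (forall s, is_derive t s (- n s / r + k s * v s)) ->
  (forall s, is_derive v s (- k s * t s)) ->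
  (forall s, is_derive n' s (t' s / r)) ->
  (forall s, is_derive t' s (- n' s / r + k s * v' s)) ->
  (forall s, is_derive v' s (- k s * t' s)) ->
  (forall u, k (c + u) = k (c - u)) ->
  n c = n' c -> t c = - t' c -> v c = v' c ->
  forall u, n (c - u) = n' (c + u).
Proof.
  intros Hn Ht Hv Hn' Ht' Hv' Hk en et ev u.
  set (E := fun u => (n (c - u) - n' (c + u)) ^ 2 + (t (c - u) + t' (c + u)) ^ 2
                     + (v (c - u) - v' (c + u)) ^ 2).
  assert (HE : forall u, is_derive E u 0).
  { intros w. unfold E. der. rewrite (Hk w). unfold Rdiv. ring. }
  pose proof (der_zero_const E HE 0 u) as h. unfold E in h.
  rewrite !Rminus_0_r, !Rplus_0_r, en, et, ev in h.
  assert ((n (c - u) - n' (c + u)) ^ 2 <= 0).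
  { pose proof (pow2_ge_0 (t (c - u) + t' (c + u))).
    pose proof (pow2_ge_0 (v (c - u) - v' (c + u))). lra. }
  pose proof (pow2_ge_0 (n (c - u) - n' (c + u))).
  assert (n (c - u) - n' (c + u) = 0); [|lra].
  apply Rsqr_0_uniq. unfold Rsqr. lra.
Qed.

(** The Darboux frame of a unit-speed curve on a sphere of radius [r], with geodesic curvature
    [k]. *)
Record spherical_frame (r : R) (N T V : R -> vec3) (k : R -> R) : Prop := {
  fr_pos : 0 < r;
  fr_N : forall e s, is_derive (fun u => dot (N u) e) s (dot (T s) e / r);
  fr_T : forall e s,
    is_derive (fun u => dot (T u) e) s (- dot (N s) e / r + k s * dot (V s) e);
  fr_V : forall e s, is_derive (fun u => dot (V u) e) s (- k s * dot (T s) e);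
  fr_NN : forall s, dot (N s) (N s) = 1;
  fr_TT : forall s, dot (T s) (T s) = 1;
  fr_NT : forall s, dot (N s) (T s) = 0;
  fr_cross : forall s, V s = cross (N s) (T s)
}.

Section Frame.

Variables (r : R) (N T V : R -> vec3) (k : R -> R).
Hypothesis F : spherical_frame r N T V k.

Lemma fr_VN s : dot (V s) (N s) = 0.
Proof. rewrite (fr_cross _ _ _ _ _ F). apply dot_cross_self_l. Qed.

Lemma fr_VT s : dot (V s) (T s) = 0.
Proof. rewrite (fr_cross _ _ _ _ _ F). apply dot_cross_self_r. Qed.

Lemma fr_VV s : dot (V s) (V s) = 1.
Proof.
  rewrite (fr_cross _ _ _ _ _ F), dot_cross_cross, (dot_sym (T s) (N s)).
  rewrite (fr_NN _ _ _ _ _ F), (fr_TT _ _ _ _ _ F), (fr_NT _ _ _ _ _ F). ring.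
Qed.

(** The reflection reverses [T c] and fixes [N c] and [V c]; these are the initial conditions of
    [frenet_reflection]. *)
Lemma frame_reflection (c : R) :
  (forall u, k (c + u) = k (c - u)) ->
  forall u e, dot (N (c - u)) e = dot (N (c + u)) (reflect (T c) e).
Proof.
  intros Hk u e.
  apply (frenet_reflection r c k
    (fun s => dot (N s) e) (fun s => dot (T s) e) (fun s => dot (V s) e)
    (fun s => dot (N s) (reflect (T c) e)) (fun s => dot (T s) (reflect (T c) e))
    (fun s => dot (V s) (reflect (T c) e)));
  try solve [intros; first [apply (fr_N _ _ _ _ _ F) | apply (fr_T _ _ _ _ _ F)
                           | apply (fr_V _ _ _ _ _ F)]];
  auto; cbv beta; unfold reflect; dots.
  - rewrite (fr_NT _ _ _ _ _ F). ring.
  - rewrite (fr_TT _ _ _ _ _ F). ring.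
  - rewrite fr_VT. ring.
Qed.

End Frame.

(** * Extremal curves *)

Section Extremal.

Variables (r C : R) (N T V : R -> vec3) (k B D : R -> R).
Hypothesis F : spherical_frame r N T V k.
Hypothesis k_pos : forall s, 0 < k s.
Hypothesis B_pos : forall s, 0 < B s.
Hypothesis kB : forall s, k s ^ 2 * B s ^ 3 = 1.
Hypothesis der_B : forall s, is_derive B s (D s).
Hypothesis der_D : forall s, is_derive D s (2 / B s ^ 2 - B s / r ^ 2 + C / 2).
Hypothesis der_k : forall s, is_derive k s (- (3 / 2) * k s * D s / B s).

Let r_pos : 0 < r := fr_pos _ _ _ _ _ F.

(* The Noether momentum of the rotations of the sphere. *)
Definition momentum (s : R) : vec3 :=
  vadd (vadd (vscal (D s) (T s)) (vscal (2 * k s * B s) (V s)))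
       (vscal (B s / r - C * r / 2) (N s)).

(** In the derivative the [V] and [N] coefficients cancel identically, and the [T] coefficient
    reduces to [2 / B^2 - 2 k^2 B], which is zero since [k^2 B^3 = 1]. *)
Lemma momentum_const (s t : R) : momentum s = momentum t.
Proof.
  apply vec_ext. intros e. revert s t.
  apply (der_zero_const (fun s => dot (momentum s) e)).
  intros s. pose proof (B_pos s) as b. pose proof (k_pos s). pose proof (kB s) as kb.
  apply der_ext with (fun s => D s * dot (T s) e + 2 * k s * B s * dot (V s) e
    + (B s / r - C * r / 2) * dot (N s) e).
  { intros u. unfold momentum. dots. ring. }
  pose proof (fr_N _ _ _ _ _ F e) as hn. pose proof (fr_T _ _ _ _ _ F e) as ht.
  pose proof (fr_V _ _ _ _ _ F e) as hv.
  der.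
  assert (k2 : k s * k s = / B s ^ 3).
  { apply (Rmult_eq_reg_r (B s ^ 3)); [|apply pow_nonzero; lra].
    rewrite Rinv_l by (apply pow_nonzero; lra). rewrite <- kb. ring. }
  field_simplify; [|lra].
  replace (k s ^ 2) with (/ B s ^ 3) by (rewrite <- k2; ring).
  field. lra.
Qed.

Lemma dot_momentum_T (s : R) : dot (momentum s) (T s) = D s.
Proof.
  unfold momentum. dots.
  rewrite (fr_TT _ _ _ _ _ F), (fr_VT _ _ _ _ _ F), (fr_NT _ _ _ _ _ F).
  ring.
Qed.

Lemma dot_momentum_V (s : R) : dot (momentum s) (V s) = 2 * k s * B s.
Proof.
  unfold momentum. dots.
  rewrite (dot_sym (T s)), (dot_sym (N s)), (fr_VV _ _ _ _ _ F), (fr_VT _ _ _ _ _ F),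
    (fr_VN _ _ _ _ _ F).
  ring.
Qed.

Lemma k_eq_of_B_eq (s t : R) : B s = B t -> k s = k t.
Proof.
  intros E. pose proof (kB s) as h1. pose proof (kB t) as h2. rewrite E in h1.
  pose proof (pow_lt (B t) 3 (B_pos t)).
  apply Rsqr_inj; try apply Rlt_le, k_pos. unfold Rsqr.
  apply (Rmult_eq_reg_r (B t ^ 3)); lra.
Qed.

(** * Symmetry of the curve about a vertex *)

Variable m : R.
Hypothesis m_pos : 0 < m.
Hypothesis B_low : forall s, m <= B s.

Lemma inv_B_le (s : R) : 0 < / B s <= / m.
Proof.
  split; [apply Rinv_0_lt_compat, B_pos | apply Rinv_le_contravar; auto].
Qed.

(** [B (c + u)] and [B (c - u)] solve the same second-order equation with the same initial data. The
    coefficient in the linear equation for their difference comes from factoring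
    [2 / x^2 - 2 / y^2], and is bounded because [B >= m]. *)
Lemma critical_symmetry (c : R) :
  D c = 0 -> forall u, B (c + u) = B (c - u) /\ D (c + u) = - D (c - u).
Proof.
  intros Dc u.
  destruct (linear_ode_zero (fun u => B (c + u) - B (c - u)) (fun u => D (c + u) + D (c - u))
    (fun u => 2 * (/ B (c - u) ^ 2 * / B (c + u) + / B (c - u) * / B (c + u) ^ 2) + / r ^ 2)
    (4 * (/ m) ^ 3 + / r ^ 2)) with (s := u) as [h1 h2].
  - intros s. der. ring.
  - intros s. pose proof (B_pos (c + s)). pose proof (B_pos (c - s)).
    der. field. repeat split; lra.
  - intros s. rewrite <- !pow_inv.
    pose proof (inv_B_le (c + s)) as [a1 a2]. pose proof (inv_B_le (c - s)) as [b1 b2].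
    assert (0 < / r ^ 2) by (apply Rinv_0_lt_compat, pow_lt, r_pos).
    set (x := / B (c + s)) in *. set (y := / B (c - s)) in *. set (z := / m) in *.
    assert (x * y <= z * z) by (apply Rmult_le_compat; lra).
    assert (0 < x * y) by (apply Rmult_lt_0_compat; lra).
    assert (x * y * (x + y) <= z * z * (z + z)) by (apply Rmult_le_compat; lra).
    assert (0 < x * y * (x + y)) by (apply Rmult_lt_0_compat; lra).
    split; nra.
  - rewrite Rplus_0_r, Rminus_0_r. ring.
  - rewrite Rplus_0_r, Rminus_0_r, Dc. ring.
  - cbv beta in h1, h2. split; lra.
Qed.

Lemma critical_reflection (c : R) :
  D c = 0 -> forall u e, dot (N (c - u)) e = dot (N (c + u)) (reflect (T c) e).
Proof.
  intros Dc. apply (frame_reflection _ _ _ _ _ F).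
  intros u. apply k_eq_of_B_eq, critical_symmetry, Dc.
Qed.

(** Differentiating the equation gives [D'' = - (4 / B^3 + 1 / r^2) D], and both initial values at
    [c] vanish. *)
Lemma D_zero_of_degenerate (c : R) :
  D c = 0 -> 2 / B c ^ 2 - B c / r ^ 2 + C / 2 = 0 -> forall s, D s = 0.
Proof.
  intros Dc Dc' s.
  destruct (linear_ode_zero (fun u => D (c + u))
    (fun u => 2 / B (c + u) ^ 2 - B (c + u) / r ^ 2 + C / 2)
    (fun u => 4 * / B (c + u) ^ 3 + / r ^ 2)
    (4 * (/ m) ^ 3 + / r ^ 2)) with (s := s - c) as [h _].
  - intros w. der. reflexivity.
  - intros w. pose proof (B_pos (c + w)). der; [apply pow_nonzero; lra|].
    field. repeat split; lra.
  - intros w. rewrite <- pow_inv.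
    pose proof (inv_B_le (c + w)) as [a1 a2].
    assert (0 < / r ^ 2) by (apply Rinv_0_lt_compat, pow_lt, r_pos).
    assert ((/ B (c + w)) ^ 3 <= (/ m) ^ 3) by (apply pow_incr; lra).
    pose proof (pow_lt _ 3 a1). lra.
  - now rewrite Rplus_0_r.
  - now rewrite Rplus_0_r.
  - now replace (c + (s - c)) with s in h by ring.
Qed.

(** * Closed curves without self-intersection *)

Variable L : R.
Hypothesis L_pos : 0 < L.
Hypothesis N_per : forall s, N (s + L) = N s.
Hypothesis B_per : forall s, B (s + L) = B s.
Hypothesis N_inj : forall s t, s < t < s + L -> N s <> N t.

Lemma D_per (s : R) : D (s + L) = D s.
Proof.
  rewrite <- (is_derive_unique B s (D s) (der_B s)).
  rewrite Rplus_comm. symmetry. apply is_derive_unique.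
  apply der_ext with (fun u => B (L + u)); [|der; reflexivity].
  intros u. rewrite Rplus_comm. apply B_per.
Qed.

(** The symmetry about [c] exchanges [c + L / 2] and [c - L / 2], which the period identifies; a
    quantity odd about [c] vanishes there. *)
Lemma antipodal_critical (c : R) : D c = 0 -> D (c + L / 2) = 0.
Proof.
  intros Dc. destruct (critical_symmetry c Dc (L / 2)) as [_ h].
  pose proof (D_per (c - L / 2)) as p.
  replace (c - L / 2 + L) with (c + L / 2) in p by lra. lra.
Qed.

Lemma tangent_odd (c u : R) : D c = 0 -> dot (N (c - u)) (T c) = - dot (N (c + u)) (T c).
Proof.
  intros Dc. rewrite (critical_reflection c Dc). unfold reflect. dots.
  rewrite (fr_TT _ _ _ _ _ F). ring.
Qed.

Lemma antipodal_tangent (c : R) : D c = 0 -> dot (N (c + L / 2)) (T c) = 0.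
Proof.
  intros Dc. pose proof (tangent_odd c (L / 2) Dc) as h.
  rewrite <- (N_per (c - L / 2)) in h.
  replace (c - L / 2 + L) with (c + L / 2) in h by lra. lra.
Qed.

(* A point of the mirror plane through [N c] met before half a period would be
   met again, at the reflected time, within the same period. *)
Lemma tangent_pos (c u : R) : D c = 0 -> 0 < u < L / 2 -> 0 < dot (N (c + u)) (T c).
Proof.
  intros Dc hu.
  pose proof (fr_N _ _ _ _ _ F (T c)) as hn.
  destruct (der_pos_sign (fun s => dot (N s) (T c)) c (dot (T c) (T c) / r)) as [e [ep He]].
  - apply hn.
  - apply F.
  - rewrite (fr_TT _ _ _ _ _ F). apply Rdiv_lt_0_compat; [lra | apply r_pos].
  (* At [c + w] the sign is known from the slope at [c]; the absence of zeros carries it over the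
     half period. *)
  - set (w := Rmin (e / 2) (L / 4)).
    assert (w_pos : 0 < w) by (apply Rmin_glb_lt; lra).
    assert (we : w <= e / 2) by apply Rmin_l.
    assert (wL : w <= L / 4) by apply Rmin_r.
    apply (no_zero_pos (fun s => dot (N s) (T c)) c (c + L / 2) (c + w)).
    + exact (der_continuity _ _ hn).
    + intros s hs Z. apply (N_inj (c - (s - c)) (c + (s - c))); [lra|].
      apply vec_ext. intros f. rewrite (critical_reflection c Dc).
      unfold reflect. dots. replace (c + (s - c)) with s by ring. rewrite Z. ring.
    + lra.
    + assert (h : 0 < Rabs (c + w - c) < e)
        by (replace (c + w - c) with w by ring; rewrite Rabs_pos_eq; lra).
      specialize (He _ h). cbv beta in He.
      replace (c + w - c) with w in He by ring. nra.
    + lra.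
Qed.

Lemma tangent_neg (c u : R) : D c = 0 -> 0 < u < L / 2 -> dot (N (c - u)) (T c) < 0.
Proof. intros Dc hu. rewrite (tangent_odd c u Dc). pose proof (tangent_pos c u Dc hu). lra. Qed.

(* The argument of the four vertex theorem, for the plane spanned by the momentum
   and [N c]. *)
Lemma no_two_vertices (c : R) :
  D c = 0 -> (forall s, c < s < c + L / 2 -> D s < 0) -> False.
Proof.
  intros Dc neg.
  (* A primitive of [k' <N, T c>]: the two terms in [<T, T c>] cancel. *)
  set (M := fun s => k s * dot (N s) (T c) + dot (V s) (T c) / r).
  pose proof (fr_N _ _ _ _ _ F (T c)) as hn.
  pose proof (fr_V _ _ _ _ _ F (T c)) as hv.
  assert (incr : M c < M (c + L / 2)).
  { apply der_pos_increasing with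
      (fun s => - (3 / 2) * k s * D s / B s * dot (N s) (T c)); [|lra|].
    - intros s. unfold M. pose proof (B_pos s). der. field. split; [|lra].
      pose proof r_pos. lra.
    - intros s hs. pose proof (k_pos s) as kp. specialize (neg s hs).
      pose proof (Rinv_0_lt_compat _ (B_pos s)) as bp.
      assert (tp : 0 < dot (N s) (T c)).
      { replace s with (c + (s - c)) by ring. apply tangent_pos; [exact Dc | lra]. }
      apply Rmult_lt_0_compat; [|exact tp]. apply Rmult_lt_0_compat; [|exact bp].
      pose proof (Rmult_lt_0_compat _ _ kp (Ropp_0_gt_lt_contravar _ neg)). lra. }
  unfold M in incr.
  rewrite (fr_NT _ _ _ _ _ F), (fr_VT _ _ _ _ _ F) in incr.
  rewrite (antipodal_tangent c Dc) in incr.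
  (* At the antipode the [T] and [N] terms of this product vanish, which leaves the [V] term. So [M]
     is zero at both ends. *)
  assert (h : dot (momentum (c + L / 2)) (T c) = 0).
  { rewrite (momentum_const _ c), dot_momentum_T. exact Dc. }
  unfold momentum in h. rewrite !dot_vadd_l, !dot_vscal_l in h.
  rewrite (antipodal_tangent c Dc), (antipodal_critical c Dc) in h.
  pose proof (Rmult_lt_0_compat _ _ (k_pos (c + L / 2)) (B_pos (c + L / 2))).
  assert (v0 : dot (V (c + L / 2)) (T c) = 0).
  { apply (Rmult_eq_reg_l (2 * (k (c + L / 2) * B (c + L / 2)))); lra. }
  rewrite v0 in incr. lra.
Qed.

Lemma momentum_neq0 (s : R) : 0 < dot (momentum s) (momentum s).
Proof.
  assert (h : momentum s <> vzero).
  { intros E. pose proof (dot_momentum_V s) as h. rewrite E in h.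
    pose proof (Rmult_lt_0_compat _ _ (k_pos s) (B_pos s)).
    assert (z : dot vzero (V s) = 0) by (unfold dot, vzero, c1, c2, c3; simpl; ring).
    lra. }
  generalize dependent (momentum s). intros [[x y] z] h.
  unfold dot, c1, c2, c3; simpl.
  destruct (Rtotal_order (x * x + y * y + z * z) 0) as [g | [g | g]]; [nra | | exact g].
  exfalso. apply h. unfold vzero.
  assert (x = 0) by nra. assert (y = 0) by nra. assert (z = 0) by nra. now subst.
Qed.

(** For [e] orthogonal to the momentum this eliminates [V] from the derivative of [T]: the
    coordinates of [N] and [T] along [e] then obey a closed linear system. *)
Lemma horizontal_relation (e : vec3) (s t : R) :
  dot (momentum t) e = 0 ->
  k s * dot (V s) e
  = - (D s * dot (T s) e + (B s / r - C * r / 2) * dot (N s) e) / (2 * B s).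
Proof.
  intros h. rewrite (momentum_const t s) in h. unfold momentum in h.
  rewrite !dot_vadd_l, !dot_vscal_l in h. pose proof (B_pos s).
  replace (k s * dot (V s) e) with (2 * k s * B s * dot (V s) e / (2 * B s)) by (field; lra).
  f_equal. lra.
Qed.

(* With angles measured around the momentum from [T c], [dot (N s) (T c)] and
   [dot (N s) (cross (T c) (momentum c))] are the sine and the cosine coordinates of
   [N s]. Their product carries the second harmonic, a Jacobi field with which [B]
   is compared. *)
Lemma no_short_arc (a c : R) :
  D a = 0 -> 2 / B a ^ 2 - B a / r ^ 2 + C / 2 < 0 ->
  a < c -> 2 * c - a <= a + L / 2 -> D c = 0 ->
  (forall s, a < s < c -> D s < 0) -> False.
Proof.
  intros Da D'a ac cL Dc neg.
  set (e1 := cross (T c) (momentum c)). set (e2 := T c).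
  assert (Te1 : dot (T c) e1 = 0) by (unfold e1; rewrite dot_sym; apply dot_cross_self_l).
  assert (Ae1 : dot (momentum c) e1 = 0)
    by (unfold e1; rewrite dot_sym; apply dot_cross_self_r).
  assert (Ae2 : dot (momentum c) e2 = 0) by (unfold e2; rewrite dot_momentum_T; exact Dc).
  assert (n2_neg : forall s, a <= s < c -> dot (N s) e2 < 0).
  { intros s hs. replace s with (c - (c - s)) by ring. apply tangent_neg; [exact Dc | lra]. }
  assert (n1_sym : forall u, dot (N (c - u)) e1 = dot (N (c + u)) e1).
  { intros u. rewrite (critical_reflection c Dc). unfold reflect. dots. rewrite Te1. ring. }
  assert (n1_c : 0 < dot (N c) e1).
  { unfold e1. rewrite <- dot_cross_assoc, <- (fr_cross _ _ _ _ _ F), dot_sym, dot_momentum_V.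
    pose proof (Rmult_lt_0_compat _ _ (k_pos c) (B_pos c)). lra. }
  (* At a zero, the part of [N (c + u)] orthogonal to the momentum is along [T c] and is reversed by
     the reflection. Then [<N, T a>] has opposite values at [c + u] and [c - u], yet both times lie
     in the half period after [a], where it is positive. *)
  assert (n1_ne : forall u, 0 < u < c - a -> dot (N (c + u)) e1 <> 0).
  { intros u hu Z.
    assert (p1 : 0 < dot (N (c + u)) (T a)).
    { replace (c + u) with (a + (c + u - a)) by ring. apply tangent_pos; [exact Da | lra]. }
    assert (p2 : 0 < dot (N (c - u)) (T a)).
    { replace (c - u) with (a + (c - u - a)) by ring. apply tangent_pos; [exact Da | lra]. }
    rewrite (critical_reflection c Dc) in p2. unfold reflect in p2.
    rewrite dot_vsub_r, dot_vscal_r in p2.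
    pose proof (orthogonal_expansion (T c) (momentum c) (N (c + u)) (T a)
      (fr_TT _ _ _ _ _ F c) Ae2) as h.
    fold e1 in h. rewrite (dot_sym e1 (N _)), Z in h.
    rewrite (momentum_const c a), dot_momentum_T, Da in h.
    rewrite (dot_sym (T c) (N _)) in h. pose proof (momentum_neq0 a).
    set (A := dot (momentum a) (momentum a)) in *.
    set (x := dot (N (c + u)) (T a)) in *.
    set (y := dot (N (c + u)) (T c) * dot (T c) (T a)) in *.
    assert (x - y = 0) by (apply (Rmult_eq_reg_l A); lra).
    unfold y in *. lra. }
  pose proof (fr_N _ _ _ _ _ F e1) as hn1. pose proof (fr_N _ _ _ _ _ F e2) as hn2.
  assert (n1_pos : forall s, a < s < c -> 0 < dot (N s) e1).
  { intros s hs.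
    apply (no_zero_pos (fun s => dot (N s) e1) a (2 * c - a) c);
      [exact (der_continuity _ _ hn1) | | lra | exact n1_c | lra].
    intros w hw. destruct (Rtotal_order w c) as [h | [-> | h]]; [ | lra | ].
    - replace w with (c - (c - w)) by ring. rewrite n1_sym. apply n1_ne. lra.
    - replace w with (c + (w - c)) by ring. apply n1_ne. lra. }
  (* The sign persists weakly at [a]: this is the bound of [pi / 2] on the angle of the arc. *)
  assert (n1_a : 0 <= dot (N a) e1).
  { destruct (Rlt_le_dec (dot (N a) e1) 0) as [h | h]; [exfalso | exact h].
    destruct (IVT_cor (fun s => dot (N s) e1) a c) as [z [hz Z]];
      [exact (der_continuity _ _ hn1) | lra | nra |].
    assert (z <> a) by (intros ->; lra). assert (z <> c) by (intros ->; lra).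
    specialize (n1_pos z). lra. }
  assert (derT : forall e, dot (momentum c) e = 0 -> forall s,
    is_derive (fun u => dot (T u) e) s (- dot (N s) e / r
      - (D s * dot (T s) e + (B s / r - C * r / 2) * dot (N s) e) / (2 * B s))).
  { intros e he s. eapply is_derive_eq; [apply (fr_T _ _ _ _ _ F)|].
    rewrite (horizontal_relation e s c he). unfold Rdiv. ring. }
  pose proof (derT e1 Ae1) as ht1. pose proof (derT e2 Ae2) as ht2. clear derT.
  (* For the product [P] of the two coordinates and derivatives in the affine parameter,
     [G = B'' P - B' P' + 2 g B P + 2 B w_1' w_2'], and [G' = (6/r^2) B B' P]. *)
  set (G := fun s =>
    (D s * D s / 2 + 2 / B s + 2 * B s * B s / r ^ 2) * r ^ 2 * (dot (N s) e1 * dot (N s) e2)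
    - r * B s * D s * (dot (T s) e1 * dot (N s) e2 + dot (N s) e1 * dot (T s) e2)
    + 2 * B s * B s * (dot (T s) e1 * dot (T s) e2)).
  pose proof r_pos as rp.
  (* On the arc [D] and the sine coordinate are negative and the cosine coordinate is positive, so
     the derivative of [G] is positive. *)
  assert (incr : G a < G c).
  { apply der_pos_increasing with
      (fun s => 6 * B s * D s * (dot (N s) e1 * dot (N s) e2)); [ | exact ac | ].
    - intros s. pose proof (B_pos s). unfold G. der; [lra|]. field. lra.
    - intros s hs. specialize (neg s hs). specialize (n1_pos s hs).
      assert (n2s : dot (N s) e2 < 0) by (apply n2_neg; lra).
      pose proof (B_pos s).
      assert (0 < - D s * - dot (N s) e2) by (apply Rmult_lt_0_compat; lra).
      assert (0 < B s * dot (N s) e1) by (apply Rmult_lt_0_compat; lra).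
      nra. }
  assert (Gc : G c = 0).
  { unfold G. rewrite Dc. unfold e2 at 1 2 3. rewrite (fr_NT _ _ _ _ _ F), Te1. ring. }
  assert (Ga : 0 <= G a); [|lra].
  unfold G. rewrite Da.
  (* The components of the momentum along [V a] and [N a]; the one along [T a] is [D a = 0]. *)
  set (al := 2 * k a * B a). set (be := B a / r - C * r / 2).
  assert (al_pos : 0 < al).
  { unfold al. pose proof (Rmult_lt_0_compat _ _ (k_pos a) (B_pos a)). lra. }
  assert (al2 : al ^ 2 * B a = 4).
  { unfold al. transitivity (4 * (k a ^ 2 * B a ^ 3)); [ring|]. rewrite kB. ring. }
  assert (mom : momentum c = vadd (vscal al (cross (N a) (T a))) (vscal be (N a))).
  { rewrite (momentum_const c a). unfold momentum. rewrite Da, (fr_cross _ _ _ _ _ F a).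
    fold al be. vec. f_equal; [f_equal|]; ring. }
  assert (hV : al * dot (V a) e2 + be * dot (N a) e2 = 0).
  { rewrite <- Ae2, mom, dot_vadd_l, !dot_vscal_l, (fr_cross _ _ _ _ _ F a). reflexivity. }
  assert (hn : dot (N a) e1 = al * dot (T a) e2).
  { unfold e1. fold e2. rewrite mom.
    transitivity (al * (dot (N a) (N a) * dot (T a) e2 - dot (N a) (T a) * dot (N a) e2)).
    - generalize (N a) (T a) e2. intros. vec. ring.
    - rewrite (fr_NN _ _ _ _ _ F), (fr_NT _ _ _ _ _ F). ring. }
  assert (ht : dot (T a) e1 = - al * dot (N a) e2 + be * dot (V a) e2).
  { unfold e1. fold e2. rewrite mom, (fr_cross _ _ _ _ _ F a).
    transitivity (al * (dot (N a) (T a) * dot (T a) e2 - dot (T a) (T a) * dot (N a) e2)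
                  + be * dot (cross (N a) (T a)) e2).
    - generalize (N a) (T a) e2. intros. vec. ring.
    - rewrite (fr_TT _ _ _ _ _ F), (fr_NT _ _ _ _ _ F). ring. }
  pose proof (n2_neg a ltac:(lra)) as n2_a.
  pose proof (B_pos a) as Bp.
  revert n1_a n2_a hV hn ht.
  generalize (dot (N a) e1) (dot (N a) e2) (dot (T a) e1) (dot (T a) e2) (dot (V a) e2).
  intros n1 n2 t1 t2 v2 n1_a n2_a hV hn ht.
  (* The negativity of the second derivative of [B] at [a], rewritten in terms of [be]. *)
  assert (be_big : 2 * r < B a ^ 2 * be).
  { assert (E : B a ^ 2 * be - 2 * r
                = - (B a ^ 2 * r) * (2 / B a ^ 2 - B a / r ^ 2 + C / 2))
      by (unfold be; field; lra).
    assert (0 < B a ^ 2 * r) by (apply Rmult_lt_0_compat; [apply pow_lt|]; lra).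
    nra. }
  assert (t2E : t2 = n1 / al) by (rewrite hn; field; lra).
  assert (v2E : v2 = - be * n2 / al).
  { apply (Rmult_eq_reg_l al); [|lra]. field_simplify; lra. }
  assert (BE : B a = 4 / al ^ 2) by (rewrite <- al2; field; lra).
  (* After elimination of [t1], [t2] and [v2], [G a] is a product whose factors have known signs. *)
  assert (E : (0 * 0 / 2 + 2 / B a + 2 * B a * B a / r ^ 2) * r ^ 2 * (n1 * n2)
    - r * B a * 0 * (t1 * n2 + n1 * t2) + 2 * B a * B a * (t1 * t2)
    = (n1 * - n2) * ((B a ^ 2 * be) ^ 2 - (2 * r) ^ 2) / (2 * B a)).
  { rewrite ht, t2E, v2E. clearbody be. rewrite BE. field. lra. }
  rewrite E. apply Rmult_le_pos; [|apply Rlt_le, Rinv_0_lt_compat; lra].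
  apply Rmult_le_pos; nra.
Qed.

Lemma extremal_critical : forall s, D s = 0.
Proof.
  destruct (periodic_max B L L_pos (der_continuity _ _ der_B) B_per) as [a Ma].
  assert (Da : D a = 0).
  { destruct (Rtotal_order (D a) 0) as [h | [h | h]]; [exfalso | exact h | exfalso].
    - destruct (der_pos_sign (fun s => - (B s - B a)) a (- D a)) as [e [ep He]];
        [der; ring | ring | lra |].
      specialize (He (a - e / 2)). specialize (Ma (a - e / 2)).
      replace (a - e / 2 - a) with (- (e / 2)) in He by ring.
      rewrite Rabs_Ropp, Rabs_pos_eq in He by lra. nra.
    - destruct (der_pos_sign (fun s => B s - B a) a (D a)) as [e [ep He]];
        [der; ring | ring | lra |].
      specialize (He (a + e / 2)). specialize (Ma (a + e / 2)).
      replace (a + e / 2 - a) with (e / 2) in He by ring.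
      rewrite Rabs_pos_eq in He by lra. nra. }
  (* The cases for the second derivative of [B] at its maximum: zero makes [B] constant, and a
     positive value is absurd. *)
  destruct (Rtotal_order (2 / B a ^ 2 - B a / r ^ 2 + C / 2) 0) as [h | [h | h]].
  - exfalso.
    destruct (der_pos_sign (fun s => - D s) a (- (2 / B a ^ 2 - B a / r ^ 2 + C / 2)))
      as [e [ep He]]; [der; ring | lra | lra |].
    assert (near : forall s, a < s < a + e -> D s < 0).
    { intros s hs. specialize (He s). rewrite Rabs_pos_eq in He by lra. nra. }
    (* The next vertex [c] comes at the latest at the antipode of [a], which is critical. *)
    destruct (first_zero D a (a + L / 2) e (der_continuity _ _ der_D) ep near)
      as [c [hc [Dc neg]]]; [lra | now apply antipodal_critical |].
    destruct (Rle_lt_dec (a + L / 2) c) as [g | g].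
    + apply (no_two_vertices a Da). intros s hs. apply neg. lra.
    + apply (no_short_arc a c Da h); auto; [lra|].
      (* Otherwise the mirror image about [c] of the critical time [a + L / 2] would be a zero of
         [D] between [a] and [c]. *)
      destruct (Rle_lt_dec (2 * c - a) (a + L / 2)) as [l | l]; [exact l | exfalso].
      destruct (critical_symmetry c Dc (a + L / 2 - c)) as [_ S].
      replace (c + (a + L / 2 - c)) with (a + L / 2) in S by ring.
      rewrite (antipodal_critical a Da) in S.
      specialize (neg (c - (a + L / 2 - c))). lra.
  - now apply (D_zero_of_degenerate a).
  - exfalso.
    destruct (der_pos_sign D a _ (der_D a) Da h) as [e [ep He]].
    assert (B a < B (a + e / 2)); [|specialize (Ma (a + e / 2)); lra].
    apply der_pos_increasing with D; [exact der_B | lra |].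
    intros s hs. specialize (He s). rewrite Rabs_pos_eq in He by lra. nra.
Qed.

End Extremal.

(** * The frame of a curve on the sphere *)

Lemma norm3_eq (v : vec3) (a : R) : 0 <= a -> (norm3 v = a <-> dot v v = a * a).
Proof.
  intros ha. unfold norm3.
  assert (0 <= dot v v) by (vec; nra).
  split; intros h.
  - rewrite <- h. symmetry. now apply sqrt_sqrt.
  - rewrite h. now apply sqrt_square.
Qed.

(** The derivatives of [f] and [g] are given only against fixed vectors, so the product rule is
    applied to coordinates. *)
Lemma der_dot (f g : R -> vec3) (f' g' : vec3) (s : R) :
  (forall e, is_derive (fun u => dot (f u) e) s (dot f' e)) ->
  (forall e, is_derive (fun u => dot (g u) e) s (dot g' e)) ->
  is_derive (fun u => dot (f u) (g u)) s (dot f' (g s) + dot (f s) g').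
Proof.
  intros Hf Hg.
  set (i := (1, 0, 0) : vec3). set (j := (0, 1, 0) : vec3). set (l := (0, 0, 1) : vec3).
  apply der_ext with (fun u => dot (f u) i * dot (g u) i + dot (f u) j * dot (g u) j
                               + dot (f u) l * dot (g u) l).
  { intros u. unfold i, j, l. generalize (f u) (g u). intros a b. vec. ring. }
  eapply is_derive_eq.
  - apply der_plus; [apply der_plus|]; apply der_mult; auto.
  - unfold i, j, l. generalize (f s) (g s). intros a b. vec. ring.
Qed.

Lemma smooth_der (x : R -> vec3) (n : nat) (e : vec3) (s : R) :
  smooth x ->
  is_derive (fun u => dot (vderive_n x n u) e) s (dot (vderive_n x (S n) s) e).
Proof.
  intros H.
  assert (h1 : forall u, is_derive (Derive_n (fun t => c1 (x t)) n) u
    (Derive_n (fun t => c1 (x t)) (S n) u)) by (intros u; apply Derive_correct, (H (S n) u)).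
  assert (h2 : forall u, is_derive (Derive_n (fun t => c2 (x t)) n) u
    (Derive_n (fun t => c2 (x t)) (S n) u)) by (intros u; apply Derive_correct, (H (S n) u)).
  assert (h3 : forall u, is_derive (Derive_n (fun t => c3 (x t)) n) u
    (Derive_n (fun t => c3 (x t)) (S n) u)) by (intros u; apply Derive_correct, (H (S n) u)).
  apply der_ext with (fun u => Derive_n (fun t => c1 (x t)) n u * c1 e
    + Derive_n (fun t => c2 (x t)) n u * c2 e + Derive_n (fun t => c3 (x t)) n u * c3 e).
  { reflexivity. }
  der. unfold dot, vderive_n, c1, c2, c3. cbn [fst snd]. ring.
Qed.

Section Curve.

Variables (o : vec3) (r : R) (x : R -> vec3).
Hypothesis r_pos : 0 < r.
Hypothesis x_smooth : smooth x.
Hypothesis x_arc : arc_length_param x.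
Hypothesis x_sphere : forall s, on_sphere o r (x s).

Let N (s : R) : vec3 := vscal (/ r) (vsub (x s) o).
Let T (s : R) : vec3 := vderive_n x 1 s.
Let V (s : R) : vec3 := cross (N s) (T s).
Let k (s : R) : R := geodesic_curvature o r x s.

Lemma normal_der (e : vec3) (s : R) :
  is_derive (fun u => dot (N u) e) s (dot (T s) e / r).
Proof.
  apply der_ext with (fun u => / r * (dot (vderive_n x 0 u) e - dot o e)).
  { intros u. unfold N. dots. reflexivity. }
  pose proof (fun s => smooth_der x 0 e s x_smooth) as h.
  der. unfold T, Rdiv. ring.
Qed.

Lemma normal_unit (s : R) : dot (N s) (N s) = 1.
Proof.
  pose proof (x_sphere s) as h. apply norm3_eq in h; [|lra].
  unfold N. rewrite dot_vscal_l, dot_vscal_r, h. field. lra.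
Qed.

Lemma tangent_unit (s : R) : dot (T s) (T s) = 1.
Proof. pose proof (x_arc s) as h. apply norm3_eq in h; [|lra]. unfold T. lra. Qed.

(** Derivative of [<N, N> = 1]; the next two lemmas likewise differentiate [<T, T> = 1] and
    [<N, T> = 0]. *)
Lemma normal_tangent (s : R) : dot (N s) (T s) = 0.
Proof.
  assert (h : dot (vscal (/ r) (T s)) (N s) + dot (N s) (vscal (/ r) (T s)) = 0).
  { apply (der_of_const (fun u => dot (N u) (N u)) 1 _ s normal_unit).
    apply der_dot; intros e; rewrite dot_vscal_l, Rmult_comm; apply normal_der. }
  revert h. dots. rewrite (dot_sym (T s)). pose proof (Rinv_0_lt_compat r r_pos). nra.
Qed.

Lemma acceleration_tangent (s : R) : dot (vderive_n x 2 s) (T s) = 0.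
Proof.
  assert (h : dot (vderive_n x 2 s) (T s) + dot (T s) (vderive_n x 2 s) = 0).
  { apply (der_of_const (fun u => dot (T u) (T u)) 1 _ s tangent_unit).
    apply der_dot; intros e; now apply smooth_der. }
  rewrite (dot_sym (T s)) in h. lra.
Qed.

Lemma acceleration_normal (s : R) : dot (N s) (vderive_n x 2 s) = - / r.
Proof.
  assert (h : dot (vscal (/ r) (T s)) (T s) + dot (N s) (vderive_n x 2 s) = 0).
  { apply (der_of_const (fun u => dot (N u) (T u)) 0 _ s normal_tangent).
    apply der_dot; intros e; [rewrite dot_vscal_l, Rmult_comm; apply normal_der|].
    now apply smooth_der. }
  rewrite dot_vscal_l, tangent_unit in h. lra.
Qed.

Lemma acceleration (e : vec3) (s : R) :
  dot (vderive_n x 2 s) e = - dot (N s) e / r + k s * dot (V s) e.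
Proof.
  rewrite (orthonormal_expansion (N s) (T s) _ _
             (normal_unit s) (tangent_unit s) (normal_tangent s)).
  rewrite acceleration_normal, (dot_sym (T s)), acceleration_tangent.
  fold (V s). rewrite (dot_sym (V s) (vderive_n x 2 s)).
  change (dot (vderive_n x 2 s) (V s)) with (k s). unfold Rdiv. ring.
Qed.

Lemma curve_frame : spherical_frame r N T V k.
Proof.
  constructor; auto using normal_der, normal_unit, tangent_unit, normal_tangent.
  - intros e s. rewrite <- acceleration. now apply smooth_der.
  (* [V' = N' x T + N x T']: the first term vanishes and the second is [k N x V = - k T]. *)
  - intros e s.
    apply der_ext with (fun u => dot (N u) (cross (T u) e)).
    { intros u. unfold V. now rewrite dot_cross_assoc. }
    eapply is_derive_eq.
    + apply (der_dot N (fun u => cross (T u) e) (vscal (/ r) (T s))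
               (cross (vderive_n x 2 s) e)).
      * intros f. rewrite dot_vscal_l, Rmult_comm. apply normal_der.
      * intros f. rewrite dot_cross_assoc.
        apply der_ext with (fun u => dot (T u) (cross e f)).
        { intros u. now rewrite dot_cross_assoc. }
        now apply smooth_der.
    + rewrite dot_vscal_l, (dot_sym (T s)), dot_cross_self_l.
      rewrite (dot_sym (N s)), dot_cross_assoc, acceleration.
      rewrite (dot_sym (N s)), dot_cross_self_r.
      unfold V. rewrite dot_cross_cross, normal_unit, (dot_sym (T s) (N s)), normal_tangent.
      unfold Rdiv. ring.
Qed.

(** * Derivatives of the geodesic curvature and of [B] *)

Let k1 (s : R) : R := dot (vderive_n x 3 s) (V s).
Let k2 (s : R) : R := dot (vderive_n x 4 s) (V s) - k s * dot (vderive_n x 3 s) (T s).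

Lemma binormal_der (e : vec3) (s : R) :
  is_derive (fun u => dot (V u) e) s (dot (vscal (- k s) (T s)) e).
Proof. rewrite dot_vscal_l. apply (fr_V _ _ _ _ _ curve_frame). Qed.

Lemma der_curvature (s : R) : is_derive k s (k1 s).
Proof.
  eapply is_derive_eq.
  - apply (der_dot (vderive_n x 2) V (vderive_n x 3 s) (vscal (- k s) (T s))).
    + intros e. now apply smooth_der.
    + intros e. apply binormal_der.
  - rewrite dot_vscal_r, acceleration_tangent. unfold k1. ring.
Qed.

Lemma der_curvature2 (s : R) : is_derive k1 s (k2 s).
Proof.
  eapply is_derive_eq.
  - apply (der_dot (vderive_n x 3) V (vderive_n x 4 s) (vscal (- k s) (T s))).
    + intros e. now apply smooth_der.
    + intros e. apply binormal_der.
  - rewrite dot_vscal_r. unfold k2. ring.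
Qed.

Hypothesis k_pos : positively_curved o r x.

Let B (s : R) : R := curvB o r x s.
Let D (s : R) : R := - (2 / 3) * k1 s / k s * B s.

Lemma B_pos (s : R) : 0 < B s.
Proof. apply exp_pos. Qed.

Lemma curvature_B (s : R) : k s ^ 2 * B s ^ 3 = 1.
Proof.
  unfold B, curvB. fold (k s). pose proof (k_pos s : 0 < k s) as kp.
  rewrite <- !Rpower_pow by (auto; apply exp_pos).
  rewrite Rpower_mult, <- Rpower_plus.
  replace (INR 2 + - (2 / 3) * INR 3) with 0 by (simpl; field).
  now apply Rpower_O.
Qed.

Lemma der_curvB (s : R) : is_derive B s (D s).
Proof.
  pose proof (k_pos s : 0 < k s) as kp.
  eapply is_derive_eq.
  - apply (is_derive_comp exp (fun u => - (2 / 3) * ln (k u))); [apply is_derive_exp|].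
    apply der_mult; [apply der_const|].
    apply (is_derive_comp ln k); [now apply is_derive_ln | apply der_curvature].
  - unfold D, B, curvB, Rpower, scal; simpl; unfold mult; simpl. fold (k s). field. lra.
Qed.

Lemma curvature_der_of_B (s : R) : is_derive k s (- (3 / 2) * k s * D s / B s).
Proof.
  eapply is_derive_eq; [apply der_curvature|].
  pose proof (k_pos s : 0 < k s). pose proof (B_pos s). unfold D. field. lra.
Qed.

Lemma der_D (C : R) (s : R) :
  extremal_equation o r x C -> is_derive D s (2 / B s ^ 2 - B s / r ^ 2 + C / 2).
Proof.
  intros E. pose proof (k_pos s : 0 < k s) as kp.
  pose proof der_curvature as h0. pose proof der_curvature2 as h1. pose proof der_curvB as h2.
  (* [Derive] is total, so the extremal equation gives only a value; differentiability of [D] comes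
     from that of [k1], [k] and [B]. *)
  assert (h : ex_derive D s).
  { eexists. unfold D. der_rec. lra. }
  apply Derive_correct in h. eapply is_derive_eq; [exact h|].
  specialize (E s). cbn [Derive_n] in E.
  rewrite (Derive_ext _ D) in E; [fold (B s) in E; unfold Rdiv in *; lra|].
  intros u. apply is_derive_unique, der_curvB.
Qed.

Section Closed.

Variables (C : R).
Hypothesis x_simple : simple_closed x.
Hypothesis E : extremal_equation o r x C.

Lemma extremal_B_const (s t : R) : B s = B t.
Proof.
  destruct x_simple as [L [L_pos [per inj]]].
  assert (vper : forall n s, vderive_n x n (s + L) = vderive_n x n s).
  { intros n u. unfold vderive_n.
    rewrite <- !Derive_n_comp_trans.
    f_equal; [f_equal|]; apply Derive_n_ext; intros w; now rewrite per. }
  assert (B_per : forall s, B (s + L) = B s).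
  { intros u. unfold B, curvB, geodesic_curvature. now rewrite !vper, per. }
  assert (N_per : forall s, N (s + L) = N s).
  { intros u. unfold N. now rewrite per. }
  assert (N_inj : forall s t, s < t < s + L -> N s <> N t).
  { intros u w h e.
    assert (xe : x u = x w).
    { apply vec_ext. intros f. apply (f_equal (fun v => r * dot v f)) in e.
      unfold N in e. rewrite !dot_vscal_l, !dot_vsub_l in e.
      rewrite <- !Rmult_assoc, Rinv_r, !Rmult_1_l in e by lra. lra. }
    (* A multiple of [L] brings [u] into [[0, L)] and [w] into [[0, 2 L)]; one more period is
       subtracted if [w] lands beyond [L]. *)
    destruct (period_shift L u L_pos) as [z Hz].
    rewrite <- (periodic_IZR x L per z u), <- (periodic_IZR x L per z w) in xe.
    set (a := u + IZR z * L) in *. assert (w + IZR z * L = a + (w - u)) as Ew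
      by (unfold a; ring). rewrite Ew in xe.
    destruct (Rlt_le_dec (a + (w - u)) L) as [g | g].
    - apply inj in xe; lra.
    - replace (a + (w - u)) with (a + (w - u) - L + L) in xe by ring.
      rewrite per in xe. apply inj in xe; lra. }
  (* The maximum of [- B] provides the positive lower bound [m]. *)
  assert (B_cont : continuity (fun s => - B s)).
  { pose proof der_curvB as h. apply der_continuity with (fun s => - D s).
    intros u. der. reflexivity. }
  destruct (periodic_max (fun s => - B s) L L_pos B_cont) as [c Hc].
  { intros u. now rewrite B_per. }
  assert (D0 : forall s, D s = 0).
  { apply (extremal_critical r C N T V k B D curve_frame k_pos B_pos curvature_B der_curvB
      (fun s => der_D C s E) curvature_der_of_B (B c)) with L; auto using B_pos.
    intros u. specialize (Hc u). lra. }
  apply der_zero_const. intros u. rewrite <- (D0 u). apply der_curvB.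
Qed.

Lemma extremal_curvature_const (s t : R) : k s = k t.
Proof.
  apply (k_eq_of_B_eq k B k_pos B_pos curvature_B), extremal_B_const.
Qed.

End Closed.

End Curve.

(** * Circles *)

Definition circle_point (q : vec3) (rho : R) (e1 e2 : vec3) (a : R) : vec3 :=
  vadd q (vscal rho (vadd (vscal (cos a) e1) (vscal (sin a) e2))).

Lemma angle_of_unit (a b : R) : a * a + b * b = 1 -> exists t, cos t = a /\ sin t = b.
Proof.
  intros h.
  assert (ha : -1 <= a <= 1) by nra.
  assert (E : sin (acos a) = Rabs b).
  { rewrite sin_acos by exact ha. replace (1 - a²) with (b²) by (unfold Rsqr; lra).
    apply sqrt_Rsqr_abs. }
  destruct (Rle_lt_dec 0 b) as [hb | hb].
  - exists (acos a). rewrite cos_acos, E, Rabs_pos_eq by assumption. now split.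
  - exists (- acos a). rewrite cos_neg, sin_neg, cos_acos, E, Rabs_left by assumption.
    split; [reflexivity | ring].
Qed.

Lemma sin2_cos2_mult (a : R) : sin a * sin a + cos a * cos a = 1.
Proof. exact (sin2_cos2 a). Qed.

(** [lam] may be negative: the orientation of the basis is chosen independently of [n]. *)
Lemma circle_parametrization (q e1 e2 n p : vec3) (rho lam : R) :
  dot e1 e1 = 1 -> dot e2 e2 = 1 -> dot e1 e2 = 0 ->
  n = vscal lam (cross e1 e2) -> lam <> 0 -> 0 < rho ->
  circle q rho n p <-> exists a, p = circle_point q rho e1 e2 a.
Proof.
  intros h1 h2 h12 -> hl hr. split.
  - intros [hd hn]. apply norm3_eq in hd; [|lra].
    rewrite dot_vscal_l in hn.
    assert (hv : dot (cross e1 e2) (vsub p q) = 0)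
      by (apply (Rmult_eq_reg_l lam); lra).
    set (v := vsub p q) in *.
    assert (X : forall f, dot v f = dot e1 v * dot e1 f + dot e2 v * dot e2 f).
    { intros f. rewrite (orthonormal_expansion e1 e2 v f h1 h2 h12), hv. ring. }
    pose proof (X v) as Xv. rewrite hd in Xv.
    destruct (angle_of_unit (dot e1 v / rho) (dot e2 v / rho)) as [a [ca sa]].
    { apply (Rmult_eq_reg_r (rho * rho)); [|nra].
      transitivity (dot e1 v * dot e1 v + dot e2 v * dot e2 v); [field|]; lra. }
    exists a. apply vec_ext. intros f. unfold circle_point. dots. rewrite ca, sa.
    specialize (X f). unfold v at 1 in X. rewrite dot_vsub_l in X.
    transitivity (dot q f + (dot e1 v * dot e1 f + dot e2 v * dot e2 f)); [lra|].
    field. lra.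
  - intros [a ->]. pose proof (sin2_cos2_mult a) as cs.
    assert (E : vsub (circle_point q rho e1 e2 a) q
                = vscal rho (vadd (vscal (cos a) e1) (vscal (sin a) e2))).
    { apply vec_ext. intros f. unfold circle_point. dots. ring. }
    split.
    + rewrite E. apply norm3_eq; [lra|]. dots.
      rewrite (dot_sym e2 e1), h1, h2, h12. nra.
    + rewrite E. dots. rewrite dot_cross_self_l, dot_cross_self_r. ring.
Qed.

Lemma unit_neq0 (v : vec3) : dot v v = 1 -> v <> vzero.
Proof. intros h ->. revert h. vec. lra. Qed.

Lemma unit_cross (e1 e2 : vec3) :
  dot e1 e1 = 1 -> dot e2 e2 = 1 -> dot e1 e2 = 0 -> dot (cross e1 e2) (cross e1 e2) = 1.
Proof. intros h1 h2 h12. rewrite dot_cross_cross, (dot_sym e2 e1), h1, h2, h12. ring. Qed.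

Lemma der_cos_sin (a b c w s : R) :
  is_derive (fun s => a + b * cos (w * s) + c * sin (w * s)) s
    (0 + c * w * cos (w * s) + - (b * w) * sin (w * s)).
Proof.
  assert (hl : is_derive (fun s : R => w * s) s w) by (der; ring).
  assert (hc : is_derive (fun s => cos (w * s)) s (- (w * sin (w * s)))).
  { eapply is_derive_eq; [apply (is_derive_comp cos (fun s => w * s));
      [apply is_derive_cos | exact hl]|].
    unfold scal; simpl; unfold mult; simpl. ring. }
  assert (hs : is_derive (fun s => sin (w * s)) s (w * cos (w * s))).
  { eapply is_derive_eq; [apply (is_derive_comp sin (fun s => w * s));
      [apply is_derive_sin | exact hl]|]. reflexivity. }
  eapply is_derive_eq.
  - apply der_plus; [apply der_plus; [apply der_const|]|];
      (apply der_mult; [apply der_const | eassumption]).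
  - cbv beta. ring.
Qed.

(** Both sides have the same initial data, so [linear_ode_zero] applies to their difference. *)
Lemma harmonic_solution (f g : R -> R) (w : R) :
  0 < w ->
  (forall s, is_derive f s (g s)) -> (forall s, is_derive g s (- (w * w * f s))) ->
  forall s, f s = f 0 * cos (w * s) + g 0 / w * sin (w * s).
Proof.
  intros wp Hf Hg s.
  set (h := fun s => 0 + f 0 * cos (w * s) + g 0 / w * sin (w * s)).
  set (h' := fun s => 0 + g 0 / w * w * cos (w * s) + - (f 0 * w) * sin (w * s)).
  assert (Hh : forall s, is_derive h s (h' s)) by (intros u; apply der_cos_sin).
  assert (Hh' : forall s, is_derive h' s (- (w * w * h s))).
  { intros u. eapply is_derive_eq; [apply der_cos_sin|]. unfold h. field. lra. }
  destruct (linear_ode_zero (fun s => f s - h s) (fun s => g s - h' s) (fun _ => w * w)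
    (w * w)) with (s := s) as [E _].
  - intros u. der. reflexivity.
  - intros u. der. ring.
  - intros _. split; nra.
  - unfold h. rewrite Rmult_0_r, cos_0, sin_0. ring.
  - unfold h'. rewrite Rmult_0_r, cos_0, sin_0. field. lra.
  - cbv beta in E. unfold h in E. lra.
Qed.

Lemma constant_curvature_circle (r : R) (N T V : R -> vec3) (k : R -> R) :
  spherical_frame r N T V k -> (forall s t, k s = k t) ->
  exists (w : R) (q e1 e2 : vec3),
    0 < w /\ dot e1 e1 = 1 /\ dot e2 e2 = 1 /\ dot e1 e2 = 0 /\
    forall s, N s = circle_point q (/ (r * w)) e1 e2 (w * s).
Proof.
  intros F kc. pose proof (fr_pos _ _ _ _ _ F) as rp.
  set (kk := k 0). assert (kE : forall s, k s = kk) by (intros s; apply kc).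
  set (w := sqrt (/ r ^ 2 + kk ^ 2)).
  assert (rr : 0 < / r ^ 2) by (apply Rinv_0_lt_compat, pow_lt, rp).
  assert (w2p : 0 < / r ^ 2 + kk ^ 2) by (pose proof (pow2_ge_0 kk); lra).
  assert (wp : 0 < w) by (apply sqrt_lt_R0, w2p).
  assert (w2 : w * w = / r ^ 2 + kk ^ 2) by (apply sqrt_sqrt; lra).
  (* [W] is the vector from the centre of the circle to the moving point: [W' = T], [T' = - w^2 W],
     its length is [1 / w], and [N - W / r] is constant. *)
  set (W := fun s => vscal (/ (w * w)) (vsub (vscal (/ r) (N s)) (vscal kk (V s)))).
  assert (WE : forall e s,
    dot (W s) e = / (w * w) * (/ r * dot (N s) e - kk * dot (V s) e)).
  { intros e s. unfold W. now dots. }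
  assert (dW : forall e s, is_derive (fun u => dot (W u) e) s (dot (T s) e)).
  { intros e s.
    pose proof (fr_N _ _ _ _ _ F e) as hn. pose proof (fr_V _ _ _ _ _ F e) as hv.
    apply der_ext with (fun s => / (w * w) * (/ r * dot (N s) e - kk * dot (V s) e)).
    { intros u. now rewrite WE. }
    der. rewrite kE, w2. field. split; [lra|].
    pose proof (pow2_ge_0 (kk * r)). lra. }
  assert (dT : forall e s, is_derive (fun u => dot (T u) e) s (- (w * w * dot (W s) e))).
  { intros e s. eapply is_derive_eq; [apply (fr_T _ _ _ _ _ F)|].
    rewrite kE, WE. field. lra. }
  assert (NW : forall s, vsub (N s) (vscal (/ r) (W s)) = vsub (N 0) (vscal (/ r) (W 0))).
  { intros s. apply vec_ext. intros e. revert s.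
    assert (h : forall s t, dot (N s) e - / r * dot (W s) e = dot (N t) e - / r * dot (W t) e).
    { apply (der_zero_const (fun s => dot (N s) e - / r * dot (W s) e)). intros s.
      pose proof (fr_N _ _ _ _ _ F e) as hn. pose proof (dW e) as hw.
      der. unfold Rdiv. ring. }
    intros s. dots. apply h. }
  exists w, (vsub (N 0) (vscal (/ r) (W 0))), (vscal w (W 0)), (T 0).
  pose proof (fr_NN _ _ _ _ _ F 0) as hNN. pose proof (fr_VN _ _ _ _ _ F 0) as hVN.
  pose proof (fr_VV _ _ _ _ _ F 0) as hVV. pose proof (fr_NT _ _ _ _ _ F 0) as hNT.
  pose proof (fr_VT _ _ _ _ _ F 0) as hVT. pose proof (fr_TT _ _ _ _ _ F 0) as hTT.
  split; [exact wp | split; [|split; [exact hTT | split]]].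
  - dots. rewrite !WE, (dot_sym (N 0) (W 0)), (dot_sym (V 0) (W 0)), !WE.
    rewrite (dot_sym (N 0) (V 0)), hNN, hVN, hVV.
    transitivity (/ (w * w) * (/ r ^ 2 + kk ^ 2)); [field; lra|].
    rewrite <- w2. field. lra.
  - dots. rewrite WE, hNT, hVT. ring.
  - intros s. rewrite <- (NW s). apply vec_ext. intros e. unfold circle_point. dots.
    pose proof (harmonic_solution (fun s => dot (W s) e) (fun s => dot (T s) e) w wp
                  (dW e) (dT e) s) as h. cbv beta in h.
    rewrite h. field. lra.
Qed.

(** Successive derivatives of [<N, n> = c] give [<T, n> = 0] and [k <V, n> = c / r] with [<V, n>]
    constant; were this constant zero, [n] would be zero. *)
Lemma planar_curvature_const (r : R) (N T V : R -> vec3) (k : R -> R) (n : vec3) (c : R) :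
  spherical_frame r N T V k -> n <> vzero -> (forall s, dot (N s) n = c) ->
  forall s t, k s = k t.
Proof.
  intros F hn hc. pose proof (fr_pos _ _ _ _ _ F) as rp.
  assert (hT : forall s, dot (T s) n = 0).
  { intros s. apply (Rmult_eq_reg_r (/ r)); [|apply Rinv_neq_0_compat; lra].
    rewrite Rmult_0_l. exact (der_of_const _ _ _ s hc (fr_N _ _ _ _ _ F n s)). }
  assert (hV : forall s t, dot (V s) n = dot (V t) n).
  { apply (der_zero_const (fun s => dot (V s) n)). intros s.
    eapply is_derive_eq; [apply (fr_V _ _ _ _ _ F)|]. rewrite hT. ring. }
  assert (hk : forall s, k s * dot (V 0) n = c / r).
  { intros s. pose proof (der_of_const _ _ _ s hT (fr_T _ _ _ _ _ F n s)) as h.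
    rewrite hc, (hV s 0) in h. unfold Rdiv in *. lra. }
  assert (V0 : dot (V 0) n <> 0).
  { intros Z. apply hn.
    assert (c0 : c = 0).
    { pose proof (hk 0) as h. rewrite Z, Rmult_0_r in h.
      apply (Rmult_eq_reg_r (/ r)); [|apply Rinv_neq_0_compat; lra].
      unfold Rdiv in h. lra. }
    apply vec_ext. intros f.
    rewrite (orthonormal_expansion (N 0) (T 0) n f (fr_NN _ _ _ _ _ F 0)
               (fr_TT _ _ _ _ _ F 0) (fr_NT _ _ _ _ _ F 0)).
    rewrite <- (fr_cross _ _ _ _ _ F), hc, hT, Z, c0.
    unfold dot, vzero, c1, c2, c3. simpl. ring. }
  intros s t. apply (Rmult_eq_reg_r (dot (V 0) n)); [|exact V0]. now rewrite !hk.
Qed.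

Lemma constant_curvature_extremal (o : vec3) (r : R) (x : R -> vec3) :
  (forall s t, geodesic_curvature o r x s = geodesic_curvature o r x t) ->
  exists C1, extremal_equation o r x C1.
Proof.
  intros H. set (B := curvB o r x 0).
  exists (2 * (- (2 * / B ^ 2) + / r ^ 2 * B)). intros s.
  assert (E : forall t, curvB o r x t = B).
  { intros t. unfold B, curvB. now rewrite (H t 0). }
  rewrite (Derive_n_ext _ _ 2 s E), Derive_n_const, E by lia. lra.
Qed.

Lemma exists_unit_orthogonal (n : vec3) : exists e, dot e e = 1 /\ dot n e = 0.
Proof.
  destruct n as [[a b] c]. unfold dot, c1, c2, c3. simpl.
  destruct (Rlt_le_dec 0 (a * a + b * b)) as [h | h].
  - set (l := sqrt (a * a + b * b)).
    assert (lp : 0 < l) by now apply sqrt_lt_R0.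
    assert (l2 : l * l = a * a + b * b) by (apply sqrt_sqrt; lra).
    exists (- b / l, a / l, 0). simpl. split; [|field; lra].
    transitivity ((a * a + b * b) / (l * l)); [field; lra|]. rewrite l2. field. lra.
  - exists (1, 0, 0). simpl. assert (a = 0) by nra. subst. split; ring.
Qed.

Lemma exists_plane_basis (n : vec3) :
  n <> vzero ->
  exists e1 e2 lam, dot e1 e1 = 1 /\ dot e2 e2 = 1 /\ dot e1 e2 = 0 /\
    0 < lam /\ n = vscal lam (cross e1 e2).
Proof.
  intros hn. destruct (exists_unit_orthogonal n) as [e1 [h1 hn1]].
  assert (np : 0 < dot n n).
  { destruct n as [[a b] c]. unfold dot, c1, c2, c3. simpl.
    destruct (Rlt_le_dec 0 (a * a + b * b + c * c)) as [g | g]; [exact g | exfalso].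
    apply hn. unfold vzero.
    assert (a = 0) by nra. assert (b = 0) by nra. assert (c = 0) by nra. now subst. }
  set (l := sqrt (dot n n)).
  assert (lp : 0 < l) by now apply sqrt_lt_R0.
  assert (l2 : l * l = dot n n) by (apply sqrt_sqrt; lra).
  exists e1, (vscal (/ l) (cross n e1)), l.
  repeat split; try assumption.
  - dots. rewrite dot_cross_cross, h1, hn1, <- l2. field. lra.
  - dots. rewrite dot_sym, dot_cross_self_r. ring.
  - apply vec_ext. intros f. dots. rewrite dot_cross_assoc. dots.
    assert (E : dot e1 (cross (cross n e1) f) = dot e1 e1 * dot n f - dot n e1 * dot e1 f)
      by (vec; ring).
    transitivity (l * / l * dot e1 (cross (cross n e1) f)).
    + rewrite E, h1, hn1. field. lra.
    + rewrite Rmult_assoc. f_equal. vec. ring.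
Qed.

(* The orientation of the basis makes [mu] positive, hence the geodesic curvature
   of the circle traversed from [e1] to [e2] positive. *)
Lemma circle_on_sphere_basis (o q n : vec3) (r rho : R) :
  0 <= r -> 0 < rho -> n <> vzero -> q <> o ->
  (forall p, circle q rho n p -> on_sphere o r p) ->
  exists e1 e2 lam mu, dot e1 e1 = 1 /\ dot e2 e2 = 1 /\ dot e1 e2 = 0 /\
    lam <> 0 /\ n = vscal lam (cross e1 e2) /\
    0 < mu /\ vsub q o = vscal mu (cross e1 e2) /\ r * r = mu * mu + rho * rho.
Proof.
  intros rp hr hn hq H.
  destruct (exists_plane_basis n hn) as [e1 [e2 [lam [h1 [h2 [h12 [lp nE]]]]]]].
  set (d := vsub q o).
  assert (S : forall a, dot d d + rho * rho
                        + 2 * rho * (cos a * dot d e1 + sin a * dot d e2) = r * r).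
  { intros a. assert (h : on_sphere o r (circle_point q rho e1 e2 a)).
    { apply H. apply (circle_parametrization q e1 e2 n _ rho lam); auto; [lra|].
      now exists a. }
    apply norm3_eq in h; [|exact rp]. rewrite <- h.
    replace (vsub (circle_point q rho e1 e2 a) o)
      with (vadd d (vscal rho (vadd (vscal (cos a) e1) (vscal (sin a) e2)))).
    - dots. rewrite (dot_sym e1 d), (dot_sym e2 d), (dot_sym e2 e1), h1, h2, h12.
      pose proof (sin2_cos2_mult a) as cs.
      transitivity (dot d d + rho * rho * (sin a * sin a + cos a * cos a)
        + 2 * rho * (cos a * dot d e1 + sin a * dot d e2)); [rewrite cs|]; ring.
    - unfold d, circle_point. apply vec_ext. intros f. dots. ring. }
  (* Angles 0 and [PI] isolate [dot d e1]; the angle [PI / 2] then isolates [dot d e2]. *)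
  pose proof (S 0) as S0. pose proof (S PI) as S1.
  pose proof (S (PI / 2)) as S2.
  rewrite cos_0, sin_0 in S0. rewrite cos_PI, sin_PI in S1. rewrite cos_PI2, sin_PI2 in S2.
  assert (d1 : dot d e1 = 0) by nra.
  assert (d2 : dot d e2 = 0) by nra.
  set (mu := dot d (cross e1 e2)).
  assert (dE : d = vscal mu (cross e1 e2)).
  { apply vec_ext. intros f. rewrite (orthonormal_expansion e1 e2 d f h1 h2 h12).
    rewrite (dot_sym e1 d), (dot_sym e2 d), (dot_sym (cross e1 e2) d), d1, d2.
    fold mu. dots. ring. }
  assert (dd : dot d d = mu * mu).
  { rewrite dE. dots. rewrite (unit_cross e1 e2 h1 h2 h12). ring. }
  assert (rr : r * r = mu * mu + rho * rho).
  { rewrite <- dd, <- S0, d1, d2. ring. }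
  (* Swapping [e1] and [e2] reverses the sign of [mu]; [mu = 0] would put [q] at [o]. *)
  destruct (Rtotal_order mu 0) as [hm | [hm | hm]].
  - exists e2, e1, (- lam), (- mu). rewrite (dot_sym e2 e1).
    repeat split; try assumption; try lra.
    + rewrite nE. vec. f_equal; [f_equal|]; ring.
    + rewrite dE. clear. vec. f_equal; [f_equal|]; ring.
  - exfalso. apply hq. apply vec_ext. intros f.
    assert (h : dot d f = 0) by (rewrite dE, hm; dots; ring).
    unfold d in h. rewrite dot_vsub_l in h. lra.
  - exists e1, e2, lam, mu. repeat split; try assumption; lra.
Qed.

(** * Arc-length parametrization of a circle on the sphere *)

Definition cos_sin (w : R) (f : R -> R) : Prop :=
  exists a b c, forall s, f s = a + b * cos (w * s) + c * sin (w * s).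

Lemma cos_sin_ex_derive (w : R) (f : R -> R) (s : R) : cos_sin w f -> ex_derive f s.
Proof.
  intros [a [b [c E]]]. eexists. eapply der_ext; [|apply der_cos_sin].
  intros u. symmetry. apply E.
Qed.

(** This closure yields derivatives of all orders by induction. *)
Lemma cos_sin_derive (w : R) (f : R -> R) : cos_sin w f -> cos_sin w (Derive f).
Proof.
  intros [a [b [c E]]]. exists 0, (c * w), (- (b * w)). intros s.
  rewrite (Derive_ext _ _ s E). apply is_derive_unique, der_cos_sin.
Qed.

Lemma cos_sin_derive_n (w : R) (f : R -> R) (n : nat) : cos_sin w f -> cos_sin w (Derive_n f n).
Proof. intros H. induction n as [|n IH]; [exact H | now apply cos_sin_derive]. Qed.

Lemma cos_sin_ex_derive_n (w : R) (f : R -> R) (n : nat) (s : R) :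
  cos_sin w f -> ex_derive_n f n s.
Proof.
  intros H. destruct n as [|n]; [exact I|].
  now apply (cos_sin_ex_derive w), cos_sin_derive_n.
Qed.

Lemma Derive_n_cos_sin_1 (a b c w s : R) (f : R -> R) :
  (forall s, f s = a + b * cos (w * s) + c * sin (w * s)) ->
  Derive_n f 1 s = w * (- sin (w * s) * b + cos (w * s) * c).
Proof.
  intros E. change (Derive_n f 1 s) with (Derive f s). rewrite (Derive_ext _ _ s E).
  etransitivity; [apply is_derive_unique, der_cos_sin | ring].
Qed.

Lemma Derive_n_cos_sin_2 (a b c w s : R) (f : R -> R) :
  (forall s, f s = a + b * cos (w * s) + c * sin (w * s)) ->
  Derive_n f 2 s = - (w * w) * (cos (w * s) * b + sin (w * s) * c).
Proof.
  intros E. change (Derive (Derive_n f 1) s = - (w * w) * (cos (w * s) * b + sin (w * s) * c)).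
  rewrite (Derive_ext _ (fun s => 0 + (c * w) * cos (w * s) + (- (b * w)) * sin (w * s))).
  - etransitivity; [apply is_derive_unique, der_cos_sin | ring].
  - intros u. rewrite (Derive_n_cos_sin_1 a b c w u f E). ring.
Qed.

Lemma cos_eq_1 (a : R) : Rabs a < 2 * PI -> cos a = 1 -> a = 0.
Proof.
  intros h E. apply Rabs_def2 in h.
  assert (s0 : sin (a / 2) = 0).
  { replace a with (2 * (a / 2)) in E by field. rewrite cos_2a_sin in E. nra. }
  destruct (Rtotal_order a 0) as [g | [g | g]]; [exfalso | exact g | exfalso].
  - assert (0 < sin (- (a / 2))) by (apply sin_gt_0; lra).
    rewrite sin_neg in *. lra.
  - assert (0 < sin (a / 2)) by (apply sin_gt_0; lra). lra.
Qed.

Section CircleCurve.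

Variables (o q e1 e2 : vec3) (r rho mu : R).
Hypothesis r_pos : 0 < r.
Hypothesis rho_pos : 0 < rho.
Hypothesis mu_pos : 0 < mu.
Hypothesis e1_unit : dot e1 e1 = 1.
Hypothesis e2_unit : dot e2 e2 = 1.
Hypothesis e12 : dot e1 e2 = 0.
Hypothesis center : vsub q o = vscal mu (cross e1 e2).
Hypothesis radii : r * r = mu * mu + rho * rho.

Let w : R := / rho.

Definition circle_curve (s : R) : vec3 := circle_point q rho e1 e2 (w * s).

Lemma circle_curve_1 (s : R) :
  c1 (circle_curve s) = c1 q + rho * c1 e1 * cos (w * s) + rho * c1 e2 * sin (w * s).
Proof. unfold circle_curve, circle_point, vadd, vscal, c1, c2, c3. simpl. ring. Qed.

Lemma circle_curve_2 (s : R) :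
  c2 (circle_curve s) = c2 q + rho * c2 e1 * cos (w * s) + rho * c2 e2 * sin (w * s).
Proof. unfold circle_curve, circle_point, vadd, vscal, c1, c2, c3. simpl. ring. Qed.

Lemma circle_curve_3 (s : R) :
  c3 (circle_curve s) = c3 q + rho * c3 e1 * cos (w * s) + rho * c3 e2 * sin (w * s).
Proof. unfold circle_curve, circle_point, vadd, vscal, c1, c2, c3. simpl. ring. Qed.

Lemma circle_curve_smooth : smooth circle_curve.
Proof.
  intros n s. split; [|split]; apply (cos_sin_ex_derive_n w); do 3 eexists.
  - exact circle_curve_1.
  - exact circle_curve_2.
  - exact circle_curve_3.
Qed.

Lemma circle_curve_velocity (s : R) :
  vderive_n circle_curve 1 s = vadd (vscal (- sin (w * s)) e1) (vscal (cos (w * s)) e2).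
Proof.
  unfold vderive_n.
  rewrite (Derive_n_cos_sin_1 _ _ _ w s _ circle_curve_1).
  rewrite (Derive_n_cos_sin_1 _ _ _ w s _ circle_curve_2).
  rewrite (Derive_n_cos_sin_1 _ _ _ w s _ circle_curve_3).
  unfold vadd, vscal, c1, c2, c3. simpl. unfold w.
  f_equal; [f_equal|]; field; lra.
Qed.

Lemma circle_curve_acceleration (s : R) :
  vderive_n circle_curve 2 s
  = vscal (- w) (vadd (vscal (cos (w * s)) e1) (vscal (sin (w * s)) e2)).
Proof.
  unfold vderive_n.
  rewrite (Derive_n_cos_sin_2 _ _ _ w s _ circle_curve_1).
  rewrite (Derive_n_cos_sin_2 _ _ _ w s _ circle_curve_2).
  rewrite (Derive_n_cos_sin_2 _ _ _ w s _ circle_curve_3).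
  unfold vadd, vscal, c1, c2, c3. simpl. unfold w.
  f_equal; [f_equal|]; field; lra.
Qed.

Lemma circle_curve_position (s : R) :
  vsub (circle_curve s) o
  = vadd (vscal mu (cross e1 e2))
      (vscal rho (vadd (vscal (cos (w * s)) e1) (vscal (sin (w * s)) e2))).
Proof.
  rewrite <- center. unfold circle_curve, circle_point.
  apply vec_ext. intros f. dots. ring.
Qed.

Lemma circle_curve_arc_length : arc_length_param circle_curve.
Proof.
  intros s. rewrite circle_curve_velocity. apply norm3_eq; [lra|]. dots.
  rewrite (dot_sym e2 e1), e1_unit, e2_unit, e12.
  rewrite <- (sin2_cos2_mult (w * s)). ring.
Qed.

Lemma circle_curve_sphere (s : R) : on_sphere o r (circle_curve s).
Proof.
  apply norm3_eq; [lra|]. rewrite circle_curve_position. dots.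
  rewrite (dot_sym e1 (cross _ _)), (dot_sym e2 (cross _ _)), (dot_sym e2 e1).
  rewrite dot_cross_self_l, dot_cross_self_r, e1_unit, e2_unit, e12.
  rewrite (unit_cross e1 e2 e1_unit e2_unit e12), radii.
  transitivity (mu * mu + rho * rho * (sin (w * s) * sin (w * s) + cos (w * s) * cos (w * s)));
    [ring|]. rewrite sin2_cos2_mult. ring.
Qed.

Lemma circle_curve_closed : simple_closed circle_curve.
Proof.
  exists (2 * PI * rho). pose proof PI_RGT_0 as pp.
  assert (wr : w * (2 * PI * rho) = 2 * PI) by (unfold w; field; lra).
  split; [apply Rmult_lt_0_compat; lra | split].
  - intros s. unfold circle_curve, circle_point.
    rewrite Rmult_plus_distr_l, wr.
    now rewrite cos_plus, sin_plus, cos_2PI, sin_2PI, !Rmult_1_r, !Rmult_0_r,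
      Rminus_0_r, Rplus_0_r.
  - intros s t hs ht E.
    (* Pairing with [e1] and [e2] equates cosines and sines, so the angle difference has cosine 1
       and is less than a full turn. *)
    assert (X : forall f, cos (w * s) * dot e1 f + sin (w * s) * dot e2 f
                          = cos (w * t) * dot e1 f + sin (w * t) * dot e2 f).
    { intros f. apply (f_equal (fun v => dot v f)) in E. revert E.
      unfold circle_curve, circle_point. dots. intros E.
      apply (Rmult_eq_reg_l rho); lra. }
    pose proof (X e1) as X1. pose proof (X e2) as X2.
    rewrite (dot_sym e2 e1), e1_unit, e12 in X1. rewrite e2_unit, e12 in X2.
    assert (Z : w * s - w * t = 0).
    { apply cos_eq_1.
      - rewrite <- Rmult_minus_distr_l, Rabs_mult, <- wr.
        assert (wp : 0 < w) by (apply Rinv_0_lt_compat; lra).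
        rewrite (Rabs_pos_eq w) by lra. apply Rmult_lt_compat_l; [exact wp|].
        apply Rabs_def1; lra.
      - rewrite cos_minus. rewrite <- (sin2_cos2_mult (w * t)).
        replace (cos (w * s)) with (cos (w * t)) by lra.
        replace (sin (w * s)) with (sin (w * t)) by lra. ring. }
    unfold w in Z. apply (f_equal (Rmult rho)) in Z. field_simplify in Z; lra.
Qed.

Lemma circle_curve_embedded : embedded_closed_on_sphere o r circle_curve.
Proof.
  split; [exact circle_curve_smooth|]. split; [exact circle_curve_arc_length|].
  split; [exact circle_curve_closed | exact circle_curve_sphere].
Qed.

Lemma circle_curve_curvature (s : R) :
  geodesic_curvature o r circle_curve s = mu / (r * rho).
Proof.
  unfold geodesic_curvature.
  rewrite circle_curve_acceleration, circle_curve_position, circle_curve_velocity.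
  set (u := vadd (vscal (cos (w * s)) e1) (vscal (sin (w * s)) e2)).
  set (v := vadd (vscal (- sin (w * s)) e1) (vscal (cos (w * s)) e2)).
  assert (E : dot u (cross (cross e1 e2) v) = - 1).
  { rewrite double_cross_l. unfold u, v. dots.
    rewrite (dot_sym e2 e1), e1_unit, e2_unit, e12.
    pose proof (sin2_cos2_mult (w * s)). lra. }
  (* The part [rho u] of the position contributes nothing, as [u] is orthogonal to [cross u v]. *)
  transitivity (- w * / r * mu * dot u (cross (cross e1 e2) v)).
  - generalize (cross e1 e2) u v. clear. intros m u v. vec. ring.
  - rewrite E. unfold w. field. lra.
Qed.

End CircleCurve.

Theorem theorem5p11 (o : vec3) (r : R) (r_pos : 0 < r) :
  (* extremal closed embedded curves are planar *)
  (forall (x : R -> vec3) (C1 : R),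
     embedded_closed_on_sphere o r x ->
     positively_curved o r x ->
     extremal_equation o r x C1 ->
     planar x) /\
  (* among closed embedded curves of nowhere zero geodesic curvature, the
     extremal ones are exactly the planar circles *)
  (forall x : R -> vec3,
     embedded_closed_on_sphere o r x ->
     positively_curved o r x ->
     (gen_equi_centro_affine_extremal o r x <-> traces_circle x)) /\
  (* every planar circle on the sphere with nonzero geodesic curvature, i.e.
     not centred at the centre of the sphere, is the trace of such a curve *)
  (forall (q : vec3) (rho : R) (n : vec3),
     0 < rho -> n <> vzero -> q <> o ->
     (forall p : vec3, circle q rho n p -> on_sphere o r p) ->
     exists x : R -> vec3,
       embedded_closed_on_sphere o r x /\
       gen_equi_centro_affine_extremal o r x /\
       (forall p : vec3, trace x p <-> circle q rho n p)).
Proof.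
  assert (circular : forall (x : R -> vec3) (C1 : R),
     embedded_closed_on_sphere o r x -> positively_curved o r x ->
     extremal_equation o r x C1 -> traces_circle x).
  { intros x C [sm [arc [cl sph]]] pos E.
    destruct (constant_curvature_circle r _ _ _ _ (curve_frame o r x r_pos sm arc sph)
      (extremal_curvature_const o r x r_pos sm arc sph pos C cl E))
      as [w [q [e1 [e2 [wp [h1 [h2 [h12 NE]]]]]]]].
    assert (wi : 0 < / w) by now apply Rinv_0_lt_compat.
    (* Undoing [N = (x - o) / r] moves the centre [q] to [o + r q] and multiplies the radius
       [1 / (r w)] by [r]. *)
    exists (vadd o (vscal r q)), (/ w), (cross e1 e2).
    split; [exact wi | split; [now apply unit_neq0, unit_cross|]].
    assert (xE : forall s, x s = circle_point (vadd o (vscal r q)) (/ w) e1 e2 (w * s)).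
    { intros s. specialize (NE s). apply vec_ext. intros f.
      apply (f_equal (fun v => r * dot v f)) in NE. revert NE.
      unfold circle_point. dots. intros NE.
      rewrite <- Rmult_assoc, Rinv_r, Rmult_1_l in NE by lra.
      rewrite Rinv_mult in NE.
      transitivity (dot o f + (dot (x s) f - dot o f)); [ring|]. rewrite NE. field. lra. }
    intros p. rewrite (circle_parametrization _ e1 e2 _ p (/ w) 1 h1 h2 h12); try lra.
    - split.
      + intros [s <-]. exists (w * s). apply xE.
      + intros [a ->]. exists (a / w). rewrite xE. f_equal. field. lra.
    - apply vec_ext. intros f. dots. ring. }
  assert (extremal_of_planar : forall (x : R -> vec3) (n : vec3) (c : R),
     embedded_closed_on_sphere o r x -> n <> vzero -> (forall s, dot n (x s) = c) ->
     exists C1, extremal_equation o r x C1).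
  { intros x n c [sm [arc [_ sph]]] hn hc. apply constant_curvature_extremal.
    (* The plane of [x] is transported to a plane containing the normals [N]. *)
    apply (planar_curvature_const r _ _ _ _ n (/ r * (c - dot o n))
             (curve_frame o r x r_pos sm arc sph) hn).
    intros s. dots. now rewrite <- (hc s), (dot_sym n). }
  assert (circle_planar : forall (x : R -> vec3) q rho n,
     (forall p, trace x p <-> circle q rho n p) -> forall s, dot n (x s) = dot n q).
  { intros x q rho n H s.
    destruct (proj1 (H (x s)) (ex_intro _ s eq_refl)) as [_ h].
    rewrite dot_vsub_r in h. lra. }
  split; [|split].
  - intros x C emb pos E. destruct (circular x C emb pos E) as [q [rho [n [_ [hn H]]]]].
    exists n, (dot n q). split; [exact hn | now apply (circle_planar x q rho)].
  - intros x emb pos. split.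
    + intros [_ [C E]]. exact (circular x C emb pos E).
    + intros [q [rho [n [_ [hn H]]]]]. split; [exact pos|].
      apply (extremal_of_planar x n (dot n q) emb hn), (circle_planar x q rho n H).
  - intros q rho n hr hn hq H.
    destruct (circle_on_sphere_basis o q n r rho (Rlt_le _ _ r_pos) hr hn hq H)
      as [e1 [e2 [lam [mu [h1 [h2 [h12 [hl [nE [hm [hd rr]]]]]]]]]]].
    pose proof (circle_curve_embedded o q e1 e2 r rho mu r_pos hr h1 h2 h12 hd rr) as emb.
    assert (tr : forall p, trace (circle_curve q e1 e2 rho) p <-> circle q rho n p).
    { intros p. rewrite (circle_parametrization q e1 e2 n p rho lam h1 h2 h12 nE hl hr).
      split.
      - intros [s <-]. now exists (/ rho * s).
      - intros [a ->]. exists (rho * a). unfold circle_curve. f_equal. field. lra. }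
    exists (circle_curve q e1 e2 rho). split; [exact emb | split; [split | exact tr]].
    + intros s. rewrite (circle_curve_curvature o q e1 e2 r rho mu) by assumption.
      apply Rdiv_lt_0_compat; [exact hm | now apply Rmult_lt_0_compat].
    + apply (extremal_of_planar _ n (dot n q) emb hn), (circle_planar _ q rho n tr).
Qed.
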